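(* Let $\tilde P=(\mathbb{Z},\preccurlyeq)$ be an affine poset of order $n\ge1$. Then the affine piping complex of $\tilde P$ is isomorphic to the acyclic nested complex of the affine poset oriented building set $(\mathcal{B}(\tilde P),\mathcal{M}(\tilde P))$ of $\tilde P$.
   Context: An affine poset of order $n\ge1$ is a poset $\tilde P=(\mathbb{Z},\preccurlyeq)$ such that: $i\prec i+n$ for all $i$; $i\preccurlyeq j\iff i+n\preccurlyeq j+n$ for all $i,j$; and for all $i,j$ there is $k\in\mathbb{N}$ with $i\preccurlyeq j+kn$. $H(\tilde P)$ is its Hasse diagram. Classes are taken modulo the translations by multiples of $n$: the element class of $i$ is $\{i+kn:k\in\mathbb{Z}\}$, the subset class of $J\subseteq\mathbb{Z}$ is $\{J+kn:k\in\mathbb{Z}\}$, and the class of a cover relation $i\prec\!\!\cdot\, j$ is $\{i+kn\prec\!\!\cdot\, j+kn:k\in\mathbb{Z}\}$. Pipings: a subset $J\subseteq\mathbb{Z}$ is convex if $i\preccurlyeq j\preccurlyeq k$ and $i,k\in J$ imply $j\in J$; connected if it induces a connected subgraph of $H(\tilde P)$; thin if $J=\mathbb{Z}$ or $J$ contains at most one element of each element class. A pipe is a thin, convex, connected subset $Q\subseteq\mathbb{Z}$ with $|Q|>1$. A pipe class is the subset class of a pipe. Two pipe classes, of $Q$ and $Q'$, are nested if $Q+kn$ and $Q'$ are nested (one contains the other) for some $k\in\mathbb{Z}$, and disjoint if $Q+kn$ and $Q'$ are disjoint for all $k\in\mathbb{Z}$. Let $\mathcal{D}(\tilde P)$ be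 the directed graph on the subsets of $\mathbb{Z}$ with an arc from $Q$ to $R$ if $Q\cap R=\varnothing$ and there are $q\in Q$, $r\in R$ with $q\prec r$. A piping of $\tilde P$ is a collection of pairwise nested or disjoint pipe classes containing the pipe class of $\mathbb{Z}$ and such that the subgraph of $\mathcal{D}(\tilde P)$ induced by all pipes belonging to these classes has no directed cycle. The affine piping complex of $\tilde P$ is the simplicial complex whose faces are the pipings with the class of $\mathbb{Z}$ removed. Oriented building set: let $S$ be the (finite) set of cover relation classes of $\tilde P$. The line graph $L(\tilde P)$ is the graph on $S$ joining the classes of $i\prec\!\!\cdot\, j$ and $i'\prec\!\!\cdot\, j'$ whenever some element class of $i,j$ equals some element class of $i',j'$. For $j\in\mathbb{Z}$ write $j=n\cdot\mathrm{quo}(j)+\mathrm{mod}(j)$ with $0\le\mathrm{mod}(j)<n$, and let $\tilde b_j=b_{\mathrm{mod}(j)}+\mathrm{quo}(j)\,b_*$, where $b_0,\dots,b_{n-1},b_*$ is the standard basis of $\mathbb{R}^{n+1}$. $\mathcal{M}(\tilde P)$ is the (acyclic) oriented matroid on $S$ of the vector configuration $A(\tilde P)$ having, for each class of cover relations $i\prec\!\!\cdot\, j$, the vector $\tilde b_i-\tilde b_j$ (which depends only on the class). A building set on $S$ is a set $\mathcal{B}$ of non-empty subsets of $S$ containing all singletons and closed under unions of two intersecting members. $\mathcal{B}(\tilde P)$ is the smallest building set on $S$ containing all non-empty subsets of $S$ inducing connected subgraphs of $L(\tilde P)$ and all supports $\underline{c}=c_+\cup c_-$ of signed circuits $c$ of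 $\mathcal{M}(\tilde P)$. A face of $\mathcal{M}(\tilde P)$ is a set $F\subseteq S$ such that some linear form vanishes on the vectors of $A(\tilde P)$ indexed by $F$ and is positive on those indexed by $S\setminus F$. For a building set $\mathcal{B}$, $\kappa(\mathcal{B})$ is the set of its inclusion-maximal elements. A nested set on $\mathcal{B}$ is a subset $\mathcal{N}\subseteq\mathcal{B}$ containing $\kappa(\mathcal{B})$ such that any two elements are nested or disjoint, and the union of any $k\ge2$ pairwise disjoint elements of $\mathcal{N}$ is not in $\mathcal{B}$. It is acyclic for $\mathcal{M}$ if $\bigcup\mathcal{N}'$ is a face of $\mathcal{M}$ for every $\mathcal{N}'\subseteq\mathcal{N}$. The acyclic nested complex of $(\mathcal{B},\mathcal{M})$ is the simplicial complex whose faces are the sets $\mathcal{N}\setminus\kappa(\mathcal{B})$ for all acyclic nested sets $\mathcal{N}$. *)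

(* Defs.v *)
From HB Require Import structures.
From mathcomp Require Import all_boot all_order all_algebra.
From mathcomp Require Import all_classical reals.
From mathcomp Require Import zify ring lra.
Set Implicit Arguments.
Unset Strict Implicit.
Unset Printing Implicit Defensive.
Import Order.TTheory GRing.Theory Num.Theory.
Local Open Scope classical_set_scope.
Local Open Scope ring_scope.

Section SetFamilies.
Context {T : Type}.
Implicit Types A B : set T.

Definition nested A B := A `<=` B \/ B `<=` A.
Definition disjoint_sets A B := A `&` B = set0.

End SetFamilies.

(* The subgraph of the undirected graph [e] induced by [A] is connected; [e] is
   expected to be symmetric.  The empty subgraph counts as connected. *)
Definition induces_connected (T : eqType) (e : rel T) (A : set T) :=
  forall x y, A x -> A y ->
    exists s : seq T, [/\ path e x s, last x s = y & forall z, z \in s -> A z].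

Definition has_directed_cycle (T : eqType) (e : rel T) (V : set T) :=
  exists c : seq T, [/\ c != [::], ucycle e c & forall z, z \in c -> V z].

(* A simplicial complex is given by its set of faces, each face being the set
   of its vertices; thus its vertices are the elements of its faces. *)
Definition vertices (V : Type) (K : set (set V)) : set V := \bigcup_(F in K) F.

Definition complex_isomorphic (V W : Type) (K : set (set V)) (L : set (set W)) :=
  exists f : V -> W, set_bij (vertices K) (vertices L) f /\
    forall F, F `<=` vertices K -> (K F <-> L (f @` F)).

Section OrientedBuildingSets.
Context {T : choiceType}.
Implicit Types (S : set T) (B : set (set T)).

Definition building_set S B :=
  [/\ forall X, B X -> X !=set0 /\ X `<=` S,
      forall s, S s -> B [set s]
    & forall X Y, B X -> B Y -> X `&` Y !=set0 -> B (X `|` Y)].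

Definition maximal_blocks B : set (set T) :=
  [set X | B X /\ forall Y, B Y -> X `<=` Y -> Y = X].

Definition nested_set B (N : set (set T)) :=
  [/\ N `<=` B, maximal_blocks B `<=` N,
      forall X Y, N X -> N Y -> nested X Y \/ disjoint_sets X Y
    & forall (k : nat) (F : nat -> set T), (2 <= k)%N ->
        (forall i, (i < k)%N -> N (F i)) -> trivIset `I_k F ->
        ~ B (\bigcup_(i < k) F i)].

(* Oriented matroid of the vector configuration [(v s)_(s in S)], where [S] is
   finite. *)
Context {R : realType} {m : nat}.
Implicit Type v : T -> 'rV[R]_m.

Definition linear_dependence S v (l : T -> R) := \sum_(s \in S) l s *: v s = 0.

(* A pair [c] stands for the signed set with positive part [c.1] and negative
   part [c.2]. *)
Definition signed_support (c : set T * set T) := c.1 `|` c.2.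

Definition signed_vector S v (c : set T * set T) :=
  exists2 l : T -> R, linear_dependence S v l &
    c = ([set s | S s /\ 0 < l s], [set s | S s /\ l s < 0]).

Definition signed_circuit S v (c : set T * set T) :=
  [/\ signed_vector S v c, signed_support c !=set0
    & forall c', signed_vector S v c' -> signed_support c' !=set0 ->
        signed_support c' `<=` signed_support c ->
        signed_support c' = signed_support c].

Definition face S v (F : set T) :=
  F `<=` S /\ exists f : {scalar 'rV[R]_m},
    (forall s, F s -> f (v s) = 0) /\ (forall s, (S `\` F) s -> 0 < f (v s)).

Definition acyclic_nested_set S v B (N : set (set T)) :=
  nested_set B N /\ forall N', N' `<=` N -> face S v (\bigcup_(X in N') X).

Definition acyclic_nested_complex S v B : set (set (set T)) :=
  [set N `\` maximal_blocks B | N in acyclic_nested_set S v B].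

End OrientedBuildingSets.

Section AffinePosets.
Variables (n : nat) (le : rel int).

Definition aff_lt (i j : int) : bool := le i j && (i != j).

Record affine_poset : Prop := AffinePoset {
  affine_refl : reflexive le;
  affine_anti : antisymmetric le;
  affine_trans : transitive le;
  affine_shift_lt : forall i, aff_lt i (i + n%:Z);
  affine_shift : forall i j, le i j = le (i + n%:Z) (j + n%:Z);
  affine_cofinal : forall i j, exists k : nat, le i (j + k%:Z * n%:Z) }.

Definition covers (i j : int) : Prop :=
  aff_lt i j /\ ~ exists k, aff_lt i k /\ aff_lt k j.

Definition hasse : rel int := fun i j => `[< covers i j \/ covers j i >].

Definition translate (k : int) (J : set int) : set int :=
  [set j + k * n%:Z | j in J].

Definition element_class (i : int) : set int := [set i + k * n%:Z | k in setT].
Definition subset_class (J : set int) : set (set int) :=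
  [set translate k J | k in setT].
Definition pair_class (p : int * int) : set (int * int) :=
  [set (p.1 + k * n%:Z, p.2 + k * n%:Z) | k in setT].

Definition convex (J : set int) :=
  forall i j k, le i j -> le j k -> J i -> J k -> J j.

Definition thin (J : set int) :=
  J = setT \/ forall i, is_subset1 (J `&` element_class i).

Definition pipe (Q : set int) :=
  [/\ thin Q, convex Q, induces_connected hasse Q
    & exists x y, [/\ Q x, Q y & x <> y]].

Definition pipe_class (C : set (set int)) := exists2 Q, pipe Q & C = subset_class Q.

Definition nested_classes (Q Q' : set int) :=
  exists k, nested (translate k Q) Q'.
Definition disjoint_classes (Q Q' : set int) :=
  forall k, disjoint_sets (translate k Q) Q'.

Definition precedes : rel (set int) := fun Q Q' =>
  `[< Q `&` Q' = set0 /\ exists q q', [/\ Q q, Q' q' & aff_lt q q'] >].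

Definition piping (X : set (set (set int))) :=
  [/\ X `<=` pipe_class, X (subset_class setT),
      forall Q Q', X (subset_class Q) -> X (subset_class Q') ->
        nested_classes Q Q' \/ disjoint_classes Q Q'
    & ~ has_directed_cycle precedes (\bigcup_(C in X) C)].

Definition affine_piping_complex : set (set (set (set int))) :=
  [set X `\` [set subset_class setT] | X in piping].

Definition cover_classes : set (set (int * int)) :=
  [set pair_class p | p in [set p | covers p.1 p.2]].

Definition line_graph : rel (set (int * int)) := fun C C' =>
  `[< exists p p', [/\ C p, C' p' &
        [\/ element_class p.1 = element_class p'.1,
            element_class p.1 = element_class p'.2,
            element_class p.2 = element_class p'.1
          | element_class p.2 = element_class p'.2]] >].

Variable R : realType.

(* [b_i] is the basis vector of index [i] for [i < n], and [b_*] the last one. *)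
Definition tilde_b (j : int) : 'rV[R]_n.+1 :=
  delta_mx 0 (inord `|(j %% n%:Z)%Z|) + ((j %/ n%:Z)%Z)%:~R *: delta_mx 0 ord_max.

(* The vector is computed on an arbitrary representative of the class, see
   [cover_vectorE]. *)
Definition cover_vector (C : set (int * int)) : 'rV[R]_n.+1 :=
  let p := xget (0, 0) C in tilde_b p.1 - tilde_b p.2.

Definition affine_building_set : set (set (set (int * int))) :=
  smallest (building_set cover_classes)
    [set X | X `<=` cover_classes /\
       ((X !=set0 /\ induces_connected line_graph X) \/
        exists2 c, signed_circuit cover_classes cover_vector c
                 & X = signed_support c)].

Lemma tilde_bD (j k : int) : (0 < n)%N ->
  tilde_b (j + k * n%:Z) = tilde_b j + k%:~R *: delta_mx 0 ord_max.
Proof.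
move=> n_gt0; rewrite /tilde_b (addrC j) modzMDl divzMDl; last by lia.
by rewrite (addrC k) intrD scalerDl addrA.
Qed.

Lemma cover_vectorE (p : int * int) : (0 < n)%N ->
  cover_vector (pair_class p) = tilde_b p.1 - tilde_b p.2.
Proof.
move=> n_gt0; rewrite /cover_vector; case: xgetP => [q _ [k _ <-] /=|/(_ p) []].
  by rewrite !tilde_bD // opprD addrACA subrr addr0.
by exists 0 => //; rewrite !mul0r !addr0; case: p.
Qed.

Lemma affine_shiftz (k i j : int) : affine_poset ->
  le (i + k * n%:Z) (j + k * n%:Z) = le i j.
Proof.
move=> leP.
have shift (m : nat) a b : le (a + m%:Z * n%:Z) (b + m%:Z * n%:Z) = le a b.
  elim: m => [|m IHm]; first by rewrite !mul0r !addr0.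
  by rewrite -[RHS]IHm [RHS](affine_shift leP); congr (le _ _); rewrite intS; ring.
case: (intP k) => [|m|m]; [by rewrite !mul0r !addr0 | exact: shift |].
rewrite -(shift m.+1 (i + _)); congr (le _ _); ring.
Qed.

Lemma finite_cover_classes : (0 < n)%N -> affine_poset ->
  finite_set cover_classes.
Proof.
move=> n_gt0 leP.
have shift_lt (x : int) (k : nat) : aff_lt x (x + k.+1%:Z * n%:Z).
  apply/andP; split; last by apply/eqP; nia.
  elim: k => [|k IHk]; first by rewrite mul1r; case/andP: (affine_shift_lt leP x).
  apply: (affine_trans leP IHk).
  have /andP[+ _] := affine_shift_lt leP (x + k.+1%:Z * n%:Z).
  by congr (le _ _); rewrite [in RHS]intS; ring.
have bounds (a r : int) : exists M : nat, forall k : int,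
    covers a (r + k * n%:Z) -> `|k| <= M%:Z.
  have [k1 le1] := affine_cofinal leP a r.
  have [k2 le2] := affine_cofinal leP r a.
  exists (k1 + k2).+1 => k [/andP[lek _] nolt].
  have le_k1 : k <= k1.+1%:Z.
    rewrite leNgt; apply/negP => lt_k; apply: nolt.
    exists (r + k1.+1%:Z * n%:Z); split.
      apply/andP; split.
        apply: (affine_trans leP le1).
        have /andP[+ _] := shift_lt (r + k1%:Z * n%:Z) 0%N.
        by congr (le _ _); rewrite [in RHS]intS; ring.
      apply/eqP => eqa; have := shift_lt (r + k1%:Z * n%:Z) 0%N.
      have -> : r + k1%:Z * n%:Z + 1%:Z * n%:Z = a.
        by rewrite eqa [in RHS]intS; ring.
      case/andP => le3 /eqP; apply; apply: (affine_anti leP).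
      by rewrite le3 le1.
    have [d dE] : exists d : nat, k = k1.+1%:Z + d.+1%:Z.
      by exists (absz (k - k1.+1%:Z - 1)%R); lia.
    have := shift_lt (r + k1.+1%:Z * n%:Z) d.
    by congr (aff_lt _ _); rewrite dE; ring.
  have le_k2 : - (k2%:Z) <= k.
    rewrite leNgt; apply/negP => lt_k.
    have [d dE] : exists d : nat, - k2%:Z = k + d.+1%:Z.
      by exists (absz (- k2%:Z - k - 1)%R); lia.
    have := shift_lt (r + k * n%:Z) d.
    have -> : r + k * n%:Z + d.+1%:Z * n%:Z = r + (- k2%:Z) * n%:Z.
      by rewrite dE; ring.
    case/andP => le3 /eqP; apply; apply: (affine_anti leP); rewrite le3 /=.
    apply: (affine_trans leP _ lek).
    have := le2; rewrite -(affine_shiftz (- k2%:Z) _ _ leP).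
    by congr (le _ _); ring.
  by lia.
pose M (a r : 'I_n) : nat := projT1 (cid (bounds a%:Z r%:Z)).
pose K := \max_a \max_r M a r.
pose g (t : 'I_n * 'I_n * 'I_(2 * K + 1)) : set (int * int) :=
  pair_class (t.1.1%:Z, t.1.2%:Z + (t.2%:Z - K%:Z) * n%:Z).
apply: (@sub_finite_set _ _ (range g)); last exact/finite_image/finite_finset.
move=> _ [[i j] /= cij <-].
have modn_lt (x : int) : (absz (x %% n%:Z)%Z < n)%N by lia.
pose a := Ordinal (modn_lt i); pose r := Ordinal (modn_lt j).
have aE : a%:Z = i - (i %/ n%:Z)%Z * n%:Z by rewrite /=; lia.
have rE : r%:Z = j - (j %/ n%:Z)%Z * n%:Z by rewrite /=; lia.
have shift_aff u x y : aff_lt (x + u * n%:Z) (y + u * n%:Z) = aff_lt x y.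
  by rewrite /aff_lt affine_shiftz // (inj_eq (addIr _)).
pose k := (j %/ n%:Z)%Z - (i %/ n%:Z)%Z.
have iE : a%:Z + (i %/ n%:Z)%Z * n%:Z = i by rewrite aE subrK.
have jE : r%:Z + k * n%:Z + (i %/ n%:Z)%Z * n%:Z = j by rewrite rE /k; ring.
have car : covers a%:Z (r%:Z + k * n%:Z).
  case: cij; rewrite -{1}iE -{1}jE shift_aff => lt_ar nolt; split => //.
  case=> x []; rewrite -(shift_aff (i %/ n%:Z)%Z) iE => lt1.
  rewrite -(shift_aff (i %/ n%:Z)%Z) jE => lt2; apply: nolt.
  by exists (x + (i %/ n%:Z)%Z * n%:Z).
have kM : `|k| <= (M a r)%:Z by apply: (projT2 (cid (bounds a%:Z r%:Z))).
have MK : (M a r <= K)%N.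
  apply: leq_trans (leq_bigmax a); exact: (leq_bigmax (F := M a)).
have k_lt : (absz (k + K%:Z)%R < 2 * K + 1)%N by lia.
exists (a, r, Ordinal k_lt) => //; rewrite /g /pair_class /=.
have -> : (absz (k + K%:Z)%R)%:Z - K%:Z = k by lia.
apply/seteqP; split => _ [u _ <-] /=.
  exists (u - (i %/ n%:Z)%Z) => //=; congr (_, _).
    by rewrite -{1}iE /=; ring.
  by rewrite -{1}jE /=; ring.
exists (u + (i %/ n%:Z)%Z) => //=; congr (_, _).
  by rewrite -[in RHS]iE /=; ring.
by rewrite -[in RHS]jE /=; ring.
Qed.

End AffinePosets.

(* Main.v *)
Require Import Defs.
From HB Require Import structures.
From mathcomp Require Import all_boot all_order all_algebra.
From mathcomp Require Import finmap all_classical reals.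
From mathcomp Require Import zify ring lra.
Set Implicit Arguments.
Unset Strict Implicit.
Unset Printing Implicit Defensive.
Import Order.TTheory GRing.Theory Num.Theory.
Local Open Scope classical_set_scope.
Local Open Scope ring_scope.

(** The isomorphism sends the class of a pipe [Q] to the set of classes of the
    cover relations inside [Q] ([edges Q]); the class of [Z] goes to the whole
    ground set [S].

    A linear form on the vectors [b_i - b_j] amounts to its values on the points
    [b_j]; up to sign this is a quasi-periodic function [h : Z -> R], that is,
    [h (i + n) = h i + c].  A face [F] of the oriented matroid is therefore the
    set of covers along which some weakly increasing quasi-periodic [h] is
    constant ([face_heightP]).  If [F <> S] then [c > 0], so the level sets of
    [h] are thin and convex, and a connected component of [F], seen as a graph
    on [Z], is a pipe ([connected_face_pipe]).

    The building set contains disconnected sets as well, but none of them is a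
    face.  Splitting a linear dependence along two parts with no common
    element class gives sums proportional to [b_*], and both vanish as soon as
    a form with nonzero value at [b_*] kills the whole support; thus the support
    of a circuit is connected or is killed by no such form
    ([circuit_support_connected]).  This alternative survives unions of
    intersecting sets, so it holds for all blocks ([building_block]), and the
    blocks that are faces are of the form [edges Q] ([block_face_pipe]).

    From a piping to a nested set, the point is that unions of the sets [edges Q]
    are faces.  The inclusion-maximal pipes involved are pairwise disjoint, and
    contracting each of them to a point gives again an affine poset because
    there is no directed cycle.  The sum over the residues [r] of the largest [k]
    such that [r + k n] lies below a given element is then a strictly increasing
    quasi-periodic function on the quotient ([affine_height],
    [contraction_height]).

    From a nested set to a piping, a directed cycle of pipes would force the
    height [h] of the union of its edge sets to take one single value on all of
    them.  Take a pipe [Q] of the cycle with maximal edge set: it is a whole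
    component of that union ([maximal_pipe_closed]), whereas the next pipe of
    the cycle contains a point above one of [Q] at the same height, hence in the same
    component, although it is disjoint from [Q]. *)

(** * Connectivity in induced subgraphs *)

Section Reachability.
Context {T : eqType} (e : rel T).
Implicit Types (A U : set T) (x y z : T).

Definition reach A x y :=
  exists s : seq T, [/\ path e x s, last x s = y & forall z, z \in s -> A z].

Lemma reach_refl A x : reach A x x.
Proof. by exists [::]. Qed.

Lemma reach_trans A x y z : reach A x y -> reach A y z -> reach A x z.
Proof.
move=> [s [es <- As]] [t [et <- At]]; exists (s ++ t); split.
- by rewrite cat_path es.
- by rewrite last_cat.
- by move=> w; rewrite mem_cat => /orP[/As|/At].
Qed.

Lemma reach1 A x y : e x y -> A y -> reach A x y.
Proof.
move=> exy Ay; exists [:: y]; split=> //= [|z]; first by rewrite exy.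
by rewrite inE => /eqP ->.
Qed.

Lemma reach_ind A U x y : U x ->
  (forall u v, U u -> e u v -> A v -> U v) -> reach A x y -> U y.
Proof.
move=> Ux stepU [s [+ <-]]; elim: s x Ux => //= z s IHs x Ux /andP[exz es] As.
apply: IHs es _; last by move=> w ws; apply: As; rewrite inE ws orbT.
by apply: stepU exz _ => //; apply: As; rewrite inE eqxx.
Qed.

Lemma reach_sub A A' x y : A `<=` A' -> reach A x y -> reach A' x y.
Proof. by move=> AA' [s [es sy As]]; exists s; split=> // z /As/AA'. Qed.

Lemma reach_sym A x y : symmetric e -> A x -> reach A x y -> reach A y x.
Proof.
move=> sym_e Ax xy; suff [] : A y /\ reach A y x by [].
apply: (reach_ind (U := fun z => A z /\ reach A z x) _ _ xy).
  by split=> //; exact: reach_refl.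
move=> u v [Au ux] euv Av.
by split=> //; apply: reach_trans ux; apply: reach1; rewrite // sym_e.
Qed.

(** Connected sets are used through this principle: a set of vertices closed
    under adjacency that meets [A] covers it. *)
Lemma connected_ind A U x : induces_connected e A -> A x -> U x ->
  (forall u v, U u -> A v -> e u v -> U v) -> A `<=` U.
Proof.
move=> cA Ax Ux stepU y Ay; apply: (reach_ind Ux _ (cA x y Ax Ay)) => u v Uu euv Av.
exact: stepU euv.
Qed.

Lemma connected_from A x : symmetric e -> A x ->
  (forall y, A y -> reach A x y) -> induces_connected e A.
Proof.
move=> sym_e Ax reachA y z Ay Az; apply: reach_trans (reachA z Az).
exact: reach_sym (reachA y Ay).
Qed.

Lemma connectedU A B : symmetric e -> induces_connected e A ->
  induces_connected e B ->
  (exists x y, [/\ A x, B y & x = y \/ e x y]) -> induces_connected e (A `|` B).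
Proof.
move=> sym_e cA cB [x [y [Ax By xy]]].
apply: (@connected_from _ x) => //; first by left.
move=> z [Az|Bz].
  by apply: (reach_sub (A := A)); [exact: subsetUl | exact: cA].
apply: (@reach_trans _ _ y).
  by case: xy => [->|exy]; [exact: reach_refl | apply: reach1 exy _; right].
by apply: (reach_sub (A := B)); [exact: subsetUr | exact: cB].
Qed.

End Reachability.

Lemma maximal_above (T : choiceType) (S : set T) (N : set (set T)) (X : set T) :
  finite_set S -> (forall Y, N Y -> Y `<=` S) -> N X ->
  exists M, [/\ N M, X `<=` M & forall Y, N Y -> M `<=` Y -> Y `<=` M].
Proof.
move=> finS NS; have [k] := ubnP #|` fset_set (S `\` X)|%fset.
elim: k X => // k IHk X ltk NX.
have [[Y [NY XY nYX]]|noY] :=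
    pselect (exists Y, [/\ N Y, X `<=` Y & ~ (Y `<=` X)]); last first.
  exists X; split=> // Y NY XY; apply: contrapT => nYX.
  by apply: noY; exists Y.
suff ltY : (#|` fset_set (S `\` Y)| < k)%N.
  have [M [NM YM maxM]] := IHk Y ltY NY.
  by exists M; split=> //; apply: subset_trans YM.
move: ltk; rewrite ltnS; apply: leq_trans; apply: fproper_ltn_card.
have [y [Yy nXy]] : exists y, Y y /\ ~ X y.
  by apply: contrapT => noy; apply: nYX => y Yy; apply: contrapT => nX; apply: noy; exists y.
have fin Z : finite_set (S `\` Z) by exact: finite_setD.
rewrite fproperE; apply/andP; split.
  apply/fsubsetP => z; rewrite !in_fset_set // !inE => -[Sz nYz].
  by split=> // Xz; apply: nYz; apply: XY.
apply/fsubsetPn; exists y; rewrite in_fset_set //; last by rewrite notin_setE => -[].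
by rewrite inE; split=> //; apply: NS Yy.
Qed.

(** * Strictly increasing quasi-periodic functions *)

(** For [r < n] let [m r j] be the largest [k] with [r + k n] below [j].  It is
    monotone in [j] and increases by [1] when [j] moves by [n], so the sum over
    all residues [r] is a quasi-periodic monotone function.  It is strictly
    monotone because for [r] the residue of [j], [m r j] is the quotient of [j],
    and reaching this value at [i] means that [j] is below [i].  A preorder
    rather than an order is allowed since the contraction of pipes makes their
    elements equivalent. *)
Lemma affine_height (n : nat) (pre : int -> int -> Prop) : (0 < n)%N ->
  (forall i, pre i i) ->
  (forall i j k, pre i j -> pre j k -> pre i k) ->
  (forall k i j, pre i j -> pre (i + k * n%:Z) (j + k * n%:Z)) ->
  (forall i, pre i (i + n%:Z)) ->
  (forall i j, exists k : int, pre i (j + k * n%:Z)) ->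
  (forall i, ~ pre (i + n%:Z) i) ->
  exists h : int -> int,
    [/\ forall i k, h (i + k * n%:Z) = h i + k * n%:Z,
        forall i j, pre i j -> h i <= h j
      & forall i j, pre i j -> ~ pre j i -> h i < h j].
Proof.
move=> n0 pre_refl pre_trans shift up cofinal irr.
have upk i (k k' : int) : k <= k' -> pre (i + k * n%:Z) (i + k' * n%:Z).
  move=> lek; have [d ->] : exists d : nat, k' = k + d%:Z.
    by exists (absz (k' - k)%R); lia.
  elim: d => [|d IHd]; first by rewrite addr0.
  apply: (pre_trans _ _ _ IHd); have := up (i + (k + d%:Z) * n%:Z).
  by congr pre; rewrite [in RHS]intS; ring.
have top r j : exists k : int, pre (r + k * n%:Z) j /\ ~ pre (r + (k + 1) * n%:Z) j.
  have [k0 k0P] := cofinal r j; have {}k0P : pre (r + (- k0) * n%:Z) j.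
    have := shift (- k0) _ _ k0P; congr pre; ring.
  have [k1 k1P] := cofinal j r.
  (* k1 bounds the k with r + k n below j, as j + n is not below j *)
  have bnd (k : int) : pre (r + k * n%:Z) j -> k <= k1.
    move=> rj; rewrite leNgt; apply/negP => ltk; apply: (irr j).
    apply: (pre_trans _ _ _ _ rj); have := shift 1 _ _ k1P; rewrite mul1r => {}k1P.
    apply: (pre_trans _ _ _ k1P); have -> : r + k1 * n%:Z + n%:Z = r + (k1 + 1) * n%:Z by ring.
    by apply: upk; lia.
  apply: contrapT => nok.
  have all (d : nat) : pre (r + (- k0 + d%:Z) * n%:Z) j.
    elim: d => [|d IHd]; first by rewrite addr0.
    apply: contrapT => nd; apply: nok; exists (- k0 + d%:Z); split=> //.
    by move: nd; congr (~ pre _ _); rewrite [in LHS]intS; ring.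
  have := bnd _ (all (absz (k1 + k0 + 1)%R)); lia.
have /choice[m' m'P] : forall p : int * int, exists k : int,
    pre (p.1 + k * n%:Z) p.2 /\ ~ pre (p.1 + (k + 1) * n%:Z) p.2.
  by move=> [r j]; exact: top.
pose m r j := m' (r, j).
have mP r j : pre (r + m r j * n%:Z) j by case: (m'P (r, j)).
have m_max r j k : pre (r + k * n%:Z) j -> k <= m r j.
  move=> rj; rewrite leNgt; apply/negP => ltk; case: (m'P (r, j)) => _; apply.
  by apply: (pre_trans _ _ _ _ rj); apply: upk; rewrite lezD1.
have m_mono r i j : pre i j -> m r i <= m r j.
  by move=> ij; apply: m_max; apply: (pre_trans _ _ _ _ ij).
exists (fun j => \sum_(r < n) m r%:Z j); split.
- move=> i k; have knE : k * n%:Z = \sum_(r < n) k.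
    by rewrite sumr_const card_ord -mulr_natr natz.
  rewrite [in RHS]knE -big_split; apply: eq_bigr => r _ /=; apply/eqP; rewrite eq_le.
  apply/andP; split.
    rewrite -lerBlDr; apply: m_max; have := shift (- k) _ _ (mP r (i + k * n%:Z)).
    congr pre; ring.
  by apply: m_max; have := shift k _ _ (mP r i); congr pre; ring.
- by move=> i j ij; apply: ler_sum => r _; apply: m_mono.
- move=> i j ij nji; have ltr : (absz (j %% n%:Z)%Z < n)%N by lia.
  rewrite (bigD1 (Ordinal ltr)) //= [ltRHS](bigD1 (Ordinal ltr)) //=.
  apply: ltr_leD; last by apply: ler_sum => r _; apply: m_mono.
  set r := `|_|%:Z.
  have jE : j = r + (j %/ n%:Z)%Z * n%:Z.
    by rewrite {1}(divz_eq j n) /r gez0_abs ?modz_ge0 1?addrC //; lia.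
  apply: (@lt_le_trans _ _ (j %/ n%:Z)%Z); last by apply: m_max; rewrite -jE.
  rewrite ltNge; apply/negP => lem; apply: nji; apply: (pre_trans _ _ _ _ (mP r i)).
  by rewrite {1}jE; apply: upk.
Qed.

(** * Cover relations, translations and classes *)
Section PosetGeometry.
Context (n : nat) (le : rel int) (n_gt0 : (0 < n)%N) (leP : affine_poset n le).
Implicit Types (Q : set int) (X : set (set (int * int))) (p : int * int).
Implicit Types (i j k x y : int).

Local Notation S := (cover_classes n le).

Lemma aff_lt_shift k i j :
  aff_lt le (i + k * n%:Z) (j + k * n%:Z) = aff_lt le i j.
Proof. by rewrite /aff_lt affine_shiftz // (inj_eq (addIr _)). Qed.

Lemma covers_shift k i j : covers le (i + k * n%:Z) (j + k * n%:Z) <-> covers le i j.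
Proof.
have shiftC m a b : covers le a b -> covers le (a + m * n%:Z) (b + m * n%:Z).
  move=> [ltab nob]; split=> [|[c]]; first by rewrite aff_lt_shift.
  rewrite -(subrK (m * n%:Z) c) !aff_lt_shift => ltc.
  by apply: nob; exists (c - m * n%:Z).
split=> [/(shiftC (- k))|]; last exact: shiftC.
by rewrite mulNr !addrK.
Qed.

Lemma coversW i j : covers le i j -> le i j.
Proof. by case=> /andP[]. Qed.

Lemma covers_neq i j : covers le i j -> i <> j.
Proof. by case=> /andP[_ /eqP]. Qed.

Lemma le_shift_nat i (k : nat) : le i (i + k%:Z * n%:Z).
Proof.
elim: k => [|k IHk]; first by rewrite mul0r addr0; exact: affine_refl leP _.
apply: (affine_trans leP IHk); have /andP[+ _] := affine_shift_lt leP (i + k%:Z * n%:Z).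
by congr (le _ _); rewrite [in RHS]intS; ring.
Qed.

Lemma shift_nle i : ~ le (i + n%:Z) i.
Proof.
move=> le1; have /andP[le2 /eqP] := affine_shift_lt leP i; apply.
by apply: (affine_anti leP); rewrite le1 le2.
Qed.

(** Intervals are finite, so that the order is generated by the covers; the
    induction is on the difference of heights of the two elements. *)
Lemma le_cover_ind (P : int -> int -> Prop) : (forall i, P i i) ->
  (forall i j k, P i j -> P j k -> P i k) ->
  (forall i j, covers le i j -> P i j) -> forall i j, le i j -> P i j.
Proof.
move=> P_refl P_trans P_cov.
have [|||||h [_ h_mono h_lt]] := @affine_height n (fun i j => le i j) n_gt0 (affine_refl leP).
- by move=> i j k ij jk; apply: (affine_trans leP ij jk).
- by move=> k i j; rewrite affine_shiftz.
- by move=> i; case/andP: (affine_shift_lt leP i).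
- by move=> i j; have [k ?] := affine_cofinal leP i j; exists k%:Z.
- exact: shift_nle.
have lt_h i j : aff_lt le i j -> h i < h j.
  case/andP=> ij /eqP neij; apply: h_lt => // ji; apply: neij.
  by apply: (affine_anti leP); rewrite ij ji.
move=> i j; have [m] := ubnP (absz (h j - h i)%R).
elim: m i j => // m IHm i j ltm ij.
have [->//|/eqP neij] := eqVneq i j.
have ltij : aff_lt le i j by rewrite /aff_lt ij; apply/eqP.
have [[k [ik kj]]|nok] := pselect (exists k, aff_lt le i k /\ aff_lt le k j).
  have := lt_h _ _ ik; have := lt_h _ _ kj => hkj hik.
  apply: (P_trans _ k); apply: IHm; rewrite ?(andP ik).1 ?(andP kj).1 //; lia.
by apply: P_cov.
Qed.

Lemma hasse_sym : symmetric (hasse le).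
Proof. by move=> i j; apply: asbool_equiv_eq; rewrite or_comm. Qed.

Lemma mem_translate k Q x : translate n k Q x <-> Q (x - k * n%:Z).
Proof.
split=> [[y Qy <-]|Qx]; first by rewrite addrK.
by exists (x - k * n%:Z) => //; rewrite subrK.
Qed.

Lemma translate_shift k Q x : Q x -> translate n k Q (x + k * n%:Z).
Proof. by move=> Qx; apply/mem_translate; rewrite addrK. Qed.

Lemma translate0 Q : translate n 0 Q = Q.
Proof. by apply/seteqP; split=> x; rewrite mem_translate mul0r subr0. Qed.

Lemma translateD k k' Q : translate n k (translate n k' Q) = translate n (k + k') Q.
Proof.
by apply/seteqP; split=> x; rewrite !mem_translate; congr Q; ring.
Qed.

Lemma translateS k Q Q' : Q `<=` Q' -> translate n k Q `<=` translate n k Q'.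
Proof. by move=> QQ' x; rewrite !mem_translate => /QQ'. Qed.

Lemma translate_subset k Q Q' : translate n k Q `<=` Q' -> Q `<=` translate n (- k) Q'.
Proof. by move/(translateS (k := - k)); rewrite translateD addNr translate0. Qed.

Lemma translateT k : translate n k setT = setT.
Proof. by apply/seteqP; split=> x // _; apply/mem_translate. Qed.

Lemma mem_subset_class Q Q' : subset_class n Q Q' <-> exists k, Q' = translate n k Q.
Proof. by split=> [[k _ <-]|[k ->]]; exists k. Qed.

Lemma subset_class_id Q : subset_class n Q Q.
Proof. by apply/mem_subset_class; exists 0; rewrite translate0. Qed.

Lemma subset_class_translate k Q : subset_class n (translate n k Q) = subset_class n Q.
Proof.
apply/seteqP; split=> A /mem_subset_class[m ->]; apply/mem_subset_class.
  by exists (m + k); rewrite translateD.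
by exists (m - k); rewrite translateD subrK.
Qed.

Lemma mem_pair_class p q :
  pair_class n p q <-> exists k, q = (p.1 + k * n%:Z, p.2 + k * n%:Z).
Proof. by split=> [[k _ <-]|[k ->]]; exists k. Qed.

Lemma pair_class_id p : pair_class n p p.
Proof. by apply/mem_pair_class; exists 0; rewrite mul0r !addr0; case: p. Qed.

Lemma pair_class_shift k p : pair_class n (p.1 + k * n%:Z, p.2 + k * n%:Z) = pair_class n p.
Proof.
apply/seteqP; split=> q /mem_pair_class[m ->]; apply/mem_pair_class => /=.
  by exists (k + m); congr (_, _); ring.
by exists (m - k); congr (_, _); ring.
Qed.

Lemma pair_class_eq p q : pair_class n p = pair_class n q ->
  exists k, p = (q.1 + k * n%:Z, q.2 + k * n%:Z).
Proof. by move=> pq; apply/mem_pair_class; rewrite -pq; exact: pair_class_id. Qed.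

Lemma element_class_eq x y : element_class n x = element_class n y <->
  exists k, x = y + k * n%:Z.
Proof.
split=> [xy|[k ->]].
  have : element_class n x x by exists 0; rewrite ?mul0r ?addr0.
  by rewrite xy => -[k _ <-]; exists k.
apply/seteqP; split=> _ [m _ <-].
  by exists (k + m) => //; ring.
by exists (m - k) => //; ring.
Qed.

Definition end_of p x := x = p.1 \/ x = p.2.

Lemma line_graphP p q : line_graph n (pair_class n p) (pair_class n q) <->
  exists k x, end_of p x /\ end_of q (x + k * n%:Z).
Proof.
split=> [/asboolP[p' [q' [/mem_pair_class[k ->] /mem_pair_class[m ->] /=]]]|].
  suff H x y : element_class n (x + k * n%:Z) = element_class n (y + m * n%:Z) ->
      end_of p x -> end_of q y -> exists k x, end_of p x /\ end_of q (x + k * n%:Z).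
    by case=> /H; apply; rewrite /end_of; auto.
  move=> /element_class_eq[d xy] px qy; exists (k - d - m), x; split=> //.
  suff -> : x + (k - d - m) * n%:Z = y by [].
  by apply: (addIr (m * n%:Z + d * n%:Z)); rewrite (addrA y) -xy; ring.
move=> [k [x [px qx]]]; apply/asboolP; exists p, q.
have cl : element_class n x = element_class n (x + k * n%:Z).
  by apply/element_class_eq; exists (- k); ring.
split; [exact: pair_class_id | exact: pair_class_id |].
by case: px => xE; case: qx => yE; rewrite xE in cl yE; rewrite yE in cl; auto using or4.
Qed.

Lemma line_graph_sym : symmetric (line_graph n).
Proof.
move=> C C'; apply: asbool_equiv_eq; split=> -[p [q [Cp Cq pq]]];
  exists q, p; split=> //; by case: pq => ->; auto using or4.
Qed.

Lemma proper_thin Q k x : thin n Q -> Q <> setT -> Q x -> Q (x + k * n%:Z) -> k = 0.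
Proof.
move=> [//|thQ] _ Qx Qxk.
have /eqP : x = x + k * n%:Z.
  by apply: (thQ x); split=> //; [exists 0; rewrite ?mul0r ?addr0 | exists k].
by rewrite -subr_eq0 opprD addNKr oppr_eq0 mulf_eq0 => /orP[/eqP//|/eqP]; lia.
Qed.

Lemma proper_thin_subset Q k : thin n Q -> Q <> setT -> Q !=set0 ->
  Q `<=` translate n k Q -> k = 0.
Proof.
move=> thQ Q1 [x Qx] QQ; apply/eqP; rewrite -oppr_eq0; apply/eqP.
by apply: (proper_thin thQ Q1 Qx); have /mem_translate := QQ _ Qx; rewrite mulNr.
Qed.

Lemma pipe_nonempty Q : pipe n le Q -> Q !=set0.
Proof. by case=> _ _ _ [x [_ [Qx _ _]]]; exists x. Qed.

(** Any two elements have a common upper bound of the form [j + k n]. *)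
Lemma pipeT : pipe n le setT.
Proof.
have up i j : le i j -> reach (hasse le) setT i j.
  apply: (le_cover_ind (P := reach (hasse le) setT)) => [x|x y z|x y xy].
  - exact: reach_refl.
  - exact: reach_trans.
  - by apply: reach1 => //; apply/asboolP; left.
split; [by left | by [] | | by exists 0, 1].
move=> i j _ _; have [k lek] := affine_cofinal leP i j.
apply: (reach_trans (up _ _ lek)); apply: reach_sym => //; first exact: hasse_sym.
by apply: up; exact: le_shift_nat.
Qed.

Lemma pipe_neighbour Q x : pipe n le Q -> Q x -> exists y, Q y /\ hasse le x y.
Proof.
move=> [_ _ cQ [a [b [Qa Qb neab]]]] Qx; apply: contrapT => noy.
have QE : Q `<=` [set x].
  apply: (connected_ind cQ Qx) => // u v -> Qv uv.
  by case: noy; exists v.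
by apply: neab; rewrite (QE _ Qa) (QE _ Qb).
Qed.

Definition edges Q : set (set (int * int)) :=
  [set pair_class n p | p in [set p | [/\ covers le p.1 p.2, Q p.1 & Q p.2]]].

Lemma mem_edges Q i j : edges Q (pair_class n (i, j)) <->
  covers le i j /\ exists k, Q (i + k * n%:Z) /\ Q (j + k * n%:Z).
Proof.
split=> [[p [cp Q1 Q2] /pair_class_eq[k pE]]|[cij [k [Qi Qj]]]].
  rewrite pE /= in cp Q1 Q2; split; first exact/(covers_shift k).
  by exists k.
exists (i + k * n%:Z, j + k * n%:Z) => /=; first by split=> //; apply/covers_shift.
exact: (pair_class_shift k (i, j)).
Qed.

Lemma edges_hasse Q x y : hasse le x y -> Q x -> Q y ->
  exists p, [/\ edges Q (pair_class n p), Q p.1, Q p.2 & p = (x, y) \/ p = (y, x)].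
Proof.
move=> /asboolP[cxy|cyx] Qx Qy; [exists (x, y)|exists (y, x)];
  by split=> //; auto; apply: imageP.
Qed.

Lemma edges_sub Q : edges Q `<=` S.
Proof. by move=> _ [p [cp _ _] <-]; exists p. Qed.

Lemma edgesT : edges setT = S.
Proof. by apply/seteqP; split=> [|_ [p cp <-]]; [exact: edges_sub | exists p]. Qed.

Lemma edgesS Q Q' : Q `<=` Q' -> edges Q `<=` edges Q'.
Proof. by move=> QQ' _ [p [cp /QQ' Q1 /QQ' Q2] <-]; exists p. Qed.

Lemma edges_translate k Q : edges (translate n k Q) = edges Q.
Proof.
have sub m A : edges (translate n m A) `<=` edges A.
  move=> _ [[i j] [/= cp /mem_translate Q1 /mem_translate Q2] <-].
  by apply/mem_edges; split=> //; exists (- m); rewrite mulNr.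
apply/seteqP; split; first exact: sub.
by rewrite -{1}(translate0 Q) -(addNr k) -translateD; exact: sub.
Qed.

Lemma edges_at Q x : pipe n le Q -> Q x -> exists p,
  [/\ edges Q (pair_class n p), Q p.1, Q p.2 & end_of p x].
Proof.
move=> pQ Qx; have [y [Qy xy]] := pipe_neighbour pQ Qx.
have [p [Ep Q1 Q2 pE]] := edges_hasse xy Qx Qy; exists p; split=> //.
by case: pE => ->; [left|right].
Qed.

Lemma edges_nonempty Q : pipe n le Q -> edges Q !=set0.
Proof.
move=> pQ; have [x Qx] := pipe_nonempty pQ.
by have [p [Ep _ _ _]] := edges_at pQ Qx; exists (pair_class n p).
Qed.

(** A path from one element of [Q] to another inside [Q] carries a path of edges:
    consecutive edges share an element. *)
Lemma edges_connected Q : pipe n le Q -> induces_connected (line_graph n) (edges Q).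
Proof.
move=> pQ; have [x Qx] := pipe_nonempty pQ.
have [p0 [Ep0 _ _ p0x]] := edges_at pQ Qx; case: (pQ) => _ _ cQ _.
apply: (connected_from line_graph_sym Ep0).
have adj p q z : end_of p z -> end_of q z -> edges Q (pair_class n q) ->
    reach (line_graph n) (edges Q) (pair_class n p) (pair_class n q).
  move=> pz qz Eq; apply: reach1 => //; apply/line_graphP.
  by exists 0, z; rewrite mul0r addr0.
pose U := [set y | forall p, edges Q (pair_class n p) -> end_of p y ->
  reach (line_graph n) (edges Q) (pair_class n p0) (pair_class n p)].
have QU : Q `<=` [set y | Q y /\ U y].
  apply: (connected_ind cQ Qx) => [|y z [Qy Uy] Qz yz].
    by split=> // p Ep px; apply: adj px Ep.
  split=> // p Ep pz; have [q [Eq _ _ qE]] := edges_hasse yz Qy Qz.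
  have [qy qz] : end_of q y /\ end_of q z by case: qE => ->; split; rewrite /end_of; auto.
  by apply: reach_trans (Uy _ Eq qy) _; apply: adj qz pz Ep.
move=> _ [p [cp Q1 Q2] <-]; have [_] := QU _ Q1; apply; last by left.
by exists p.
Qed.

(** Edge sets are blind to translations, whence the factor [k]: it is fixed by the
    position of one edge and then propagates along [Q], since a thin pipe [Q']
    contains at most one translate of each edge. *)
Lemma edges_subset Q Q' : pipe n le Q -> pipe n le Q' -> edges Q `<=` edges Q' ->
  exists k, translate n k Q `<=` Q'.
Proof.
move=> pQ [thQ' _ _ _] QQ'.
have [->|/eqP Q'T] := eqVneq Q' setT; first by exists 0.
have [x Qx] := pipe_nonempty pQ; have [p [Ep Q1 Q2 px]] := edges_at pQ Qx.
case: (pQ) => _ _ cQ _.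
move: (QQ' _ Ep); case: p Ep Q1 Q2 px => i j /= Ep Qi Qj px /mem_edges[_ [k [Q'i Q'j]]].
exists k => y /mem_translate; rewrite -{2}(subrK (k * n%:Z) y); move: (y - _) => {}y Qy.
suff QU : Q `<=` [set z | Q z /\ Q' (z + k * n%:Z)] by case: (QU _ Qy).
apply: (connected_ind cQ Qi) => // u v [Qu Q'u] Qv uv; split=> //.
have [[a b] [/QQ'/mem_edges[_ [m [Q'a Q'b]]] _ _ abE]] := edges_hasse uv Qu Qv.
have [{}Q'a {}Q'b] : Q' (u + m * n%:Z) /\ Q' (v + m * n%:Z).
  by case: abE Q'a Q'b => -[-> ->].
suff -> : k = m by [].
apply/eqP; rewrite -subr_eq0; apply/eqP; apply: (proper_thin thQ' Q'T Q'a).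
by have -> : u + m * n%:Z + (k - m) * n%:Z = u + k * n%:Z by ring.
Qed.

(** * Faces as level sets of heights *)

Definition lift X : rel int := fun i j =>
  `[< (covers le i j /\ X (pair_class n (i, j))) \/
      (covers le j i /\ X (pair_class n (j, i))) >].

Lemma lift_sym X : symmetric (lift X).
Proof. by move=> i j; apply: asbool_equiv_eq; rewrite or_comm. Qed.

Lemma lift_hasse X i j : lift X i j -> hasse le i j.
Proof. by move=> /asboolP ij; apply/asboolP; case: ij => -[]; auto. Qed.

Section Heights.
Context {R : realType}.
Implicit Types (F : set (set (int * int))) (h : int -> R) (c : R).

(** [h] is, up to sign, the function on the points [b_j] of a linear form that
    exhibits [F] as a face; with the same sign, [c] is its value on [b_*]. *)
Definition height F h c :=
  (forall i k, h (i + k * n%:Z) = h i + k%:~R * c) /\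
  (forall i j, covers le i j -> (F (pair_class n (i, j)) -> h i = h j) /\
                                (~ F (pair_class n (i, j)) -> h i < h j)).

Definition row_form (w : 'rV[R]_n.+1) (u : 'rV[R]_n.+1) : R := (u *m w^T) 0 0.

Lemma row_form_linear w : linear_for *%R (row_form w).
Proof. by move=> a u v; rewrite /row_form mulmxDl -scalemxAl !mxE. Qed.

HB.instance Definition _ w := @GRing.isLinear.Build R 'rV[R]_n.+1 R *%R (row_form w)
  (row_form_linear w).

Lemma row_form_delta w r : row_form w (delta_mx 0 r) = w 0 r.
Proof. by rewrite /row_form -rowE !mxE. Qed.

Lemma form_height F (f : {scalar 'rV[R]_n.+1}) :
  (forall s, F s -> f (cover_vector n R s) = 0) ->
  (forall s, (S `\` F) s -> 0 < f (cover_vector n R s)) ->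
  height F (fun j => - f (tilde_b n R j)) (- f (delta_mx 0 ord_max)).
Proof.
move=> f0 fpos; split=> [i k|i j cij].
  rewrite tilde_bD // linearD linearZ /=; ring.
have fE : f (cover_vector n R (pair_class n (i, j))) =
    f (tilde_b n R i) - f (tilde_b n R j) by rewrite cover_vectorE // linearB.
split=> [/f0|nF]; first by rewrite fE; lra.
suff : 0 < f (cover_vector n R (pair_class n (i, j))) by rewrite fE; lra.
by apply: fpos; split=> //; exists (i, j).
Qed.

Lemma face_heightP F : face S (@cover_vector n R) F <->
  F `<=` S /\ exists h c, height F h c.
Proof.
split=> [[FS [f [f0 fpos]]]|[FS [h [c [hD hF]]]]]; split=> //.
  by do 2!eexists; exact: form_height f0 fpos.
pose w : 'rV[R]_n.+1 := \row_(r < n.+1) (if r == n :> nat then - c else - h r%:Z).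
have wb j : row_form w (tilde_b n R j) = - h j.
  rewrite linearD linearZ /= !row_form_delta !mxE /= eqxx.
  have ltj : (`|(j %% n%:Z)%Z| < n)%N by lia.
  rewrite inordK; last exact: ltnW.
  have -> : h j = h (`|(j %% n%:Z)%Z|%N)%:Z + (j %/ n%:Z)%Z%:~R * c.
    by rewrite -hD; congr h; lia.
  by rewrite ltn_eqF //; ring.
have wE i j : row_form w (cover_vector n R (pair_class n (i, j))) = h j - h i.
  by rewrite cover_vectorE // linearB /= !wb; ring.
exists (row_form w : {scalar _}); split=> [s Fs|s [[[i j] /= cij <-] nFs]].
  have [[i j] /= cij sE] := FS _ Fs; rewrite -sE wE.
  by rewrite (hF i j cij).1 ?subrr // sE.
by rewrite wE subr_gt0; apply: (hF i j cij).2.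
Qed.

Lemma face_full : face S (@cover_vector n R) S.
Proof.
apply/face_heightP; split=> //; exists (fun=> 0), 0; split=> [*|i j cij].
  by rewrite mulr0 addr0.
by split=> // -[]; exists (i, j).
Qed.

Lemma height_le F h c i j : height F h c -> le i j ->
  h i <= h j /\ (h i = h j -> reach (lift F) setT i j).
Proof.
move=> [_ hF]; apply: (le_cover_ind
    (P := fun i j => h i <= h j /\ (h i = h j -> reach (lift F) setT i j))).
- by move=> x; split=> // _; exact: reach_refl.
- move=> x y z [xy rxy] [yz ryz]; split=> [|xz]; first exact: le_trans yz.
  by apply: (@reach_trans _ _ _ _ y); [apply: rxy|apply: ryz]; lra.
- move=> x y cxy; have [h0 h1] := hF _ _ cxy.
  have [Fxy|/h1 ltxy] := pselect (F (pair_class n (x, y))).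
    by rewrite (h0 Fxy); split=> // _; apply: reach1 => //; apply/asboolP; left.
  by split=> [|eqxy]; [exact: ltW | move: ltxy; rewrite eqxy ltxx].
Qed.

Lemma height_lift F h c i j : height F h c -> lift F i j -> h i = h j.
Proof.
by move=> [_ hF] /asboolP[[cij Fij]|[cij Fij]]; rewrite ((hF _ _ cij).1 Fij).
Qed.

Lemma height_reach F h c i j : height F h c -> reach (lift F) setT i j -> h i = h j.
Proof.
move=> hF; apply: (reach_ind (U := fun j => h i = h j)) => // u v -> uv _.
exact: height_lift hF uv.
Qed.

(** A cover [i, j] outside [F] gives [h i < h j <= h (i + k n) = h i + k c]. *)
Lemma height_step_gt0 F h c : F `<=` S -> F <> S -> height F h c -> 0 < c.
Proof.
move=> FS neFS hF.
have [[i j] [cij nF]] : exists p, covers le p.1 p.2 /\ ~ F (pair_class n p).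
  apply: contrapT => noP; apply: neFS; apply/seteqP; split=> // _ [p cp <-].
  by apply: contrapT => nFp; apply: noP; exists p.
have ltij := (hF.2 i j cij).2 nF; have [k lek] := affine_cofinal leP j i.
have [lejk _] := height_le hF lek; have := lt_le_trans ltij lejk.
rewrite hF.1 ltrDl => kc; rewrite ltNge; apply/negP => c0.
by move: kc; rewrite ltNge mulr_ge0_le0 // ler0z.
Qed.

(** The pipe is the component of one edge in [lift F].  It lies in a level set of
    [h], hence is thin since [c > 0] and convex since [h] is monotone.  As [F] is
    connected in the line graph, every class in [F] has a representative in
    this component. *)
Lemma connected_face_pipe F : F `<=` S -> F !=set0 -> F <> S ->
  face S (@cover_vector n R) F -> induces_connected (line_graph n) F ->
  exists2 Q, pipe n le Q & F = edges Q.
Proof.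
move=> FS [C0 F0] neFS /face_heightP[_ [h [c hF]]] cF.
have c_gt0 := height_step_gt0 FS neFS hF.
have [[i0 j0] /= cij0 C0E] := FS _ F0; rewrite -C0E in F0 => {C0 C0E}.
pose Q := [set x | reach (lift F) setT i0 x].
have Qlift x y : Q x -> lift F x y -> Q y.
  by move=> Qx xy; apply: reach_trans Qx _; exact: reach1.
have hQ x y : Q x -> Q y -> h x = h y.
  by move=> /(height_reach hF) <- /(height_reach hF).
have Qi0 : Q i0 by exact: reach_refl.
have Qj0 : Q j0 by apply: Qlift Qi0 _; apply/asboolP; left.
have pQ : pipe n le Q.
  split.
  - right=> x y z [Qy [a _ yE]] [Qz [b _ zE]]; have := hQ _ _ Qy Qz.
    rewrite -yE -zE !hF.1 => /addrI/(mulIf (lt0r_neq0 c_gt0))/eqP.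
    by rewrite eqr_int => /eqP ->.
  - move=> x y z xy yz Qx Qz; have [lexy rxy] := height_le hF xy.
    have [leyz _] := height_le hF yz; apply: (reach_trans Qx); apply: rxy.
    by apply/eqP; rewrite eq_le lexy (hQ _ _ Qx Qz).
  - apply: (connected_from hasse_sym Qi0) => y Qy.
    suff [] : Q y /\ reach (hasse le) Q i0 y by [].
    apply: (reach_ind (U := fun y => Q y /\ reach (hasse le) Q i0 y) _ _ Qy).
      by split=> //; exact: reach_refl.
    move=> u v [Qu ru] uv _; have Qv := Qlift _ _ Qu uv; split=> //.
    by apply: reach_trans ru _; apply: reach1 => //; exact: lift_hasse uv.
  - by exists i0, j0; split=> //; exact: covers_neq cij0.
exists Q => //; apply/seteqP; split=> [|_ [[i j] [/= cij Qi Qj] <-]]; last first.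
  apply: contrapT => /(hF.2 i j cij).2; by rewrite (hQ _ _ Qi Qj) ltxx.
apply: (connected_ind cF F0) => [|C D [[i j] [/= cij Qi Qj] <-] FD].
  by exists (i0, j0).
have [[i' j'] /= cij' DE] := FS _ FD; rewrite -DE in FD *.
move=> /line_graphP[k [x [xij xij']]]; apply/mem_edges; split=> //; exists (- k).
have Qx : Q x by case: xij => ->.
have lij : lift F (i' + (- k) * n%:Z) (j' + (- k) * n%:Z).
  apply/asboolP; left; split; first exact/covers_shift.
  by rewrite (pair_class_shift (- k) (i', j')).
case: xij' => /= xE.
  have Qi' : Q (i' + - k * n%:Z) by rewrite -xE mulNr addrK.
  by split=> //; apply: Qlift lij.
have Qj' : Q (j' + - k * n%:Z) by rewrite -xE mulNr addrK.
by split=> //; apply: Qlift Qj' _; rewrite lift_sym.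
Qed.

End Heights.

(** * Blocks that are faces *)
Section BuildingSet.
Context {R : realType}.
Implicit Types (f : {scalar 'rV[R]_n.+1}) (c : set (set (int * int)) * set (set (int * int))).
Local Notation v := (@cover_vector n R).
Local Notation B := (affine_building_set n le R).
Local Notation b_star := (delta_mx 0 ord_max : 'rV[R]_n.+1).

Lemma cover_vector_coord p (r : 'I_n.+1) : (r < n)%N -> v (pair_class n p) 0 r != 0 ->
  exists x k, end_of p x /\ x = r%:Z + k * n%:Z.
Proof.
move=> ltr; have r_max : (r == ord_max) = false by rewrite -val_eqE /= ltn_eqF.
rewrite cover_vectorE // !mxE /= r_max !mulr0 !addr0.
have lt_mod x : (`|(x %% n%:Z)%Z| < n.+1)%N by lia.
have [rE _|ne1] := eqVneq r (inord `|(p.1 %% n%:Z)%Z|).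
  exists p.1, (p.1 %/ n%:Z)%Z; split; first by left.
  by rewrite rE inordK //; lia.
have [rE _|ne2] := eqVneq r (inord `|(p.2 %% n%:Z)%Z|).
  exists p.2, (p.2 %/ n%:Z)%Z; split; first by right.
  by rewrite rE inordK //; lia.
by rewrite subrr eqxx.
Qed.

Lemma common_coord_adjacent s t (r : 'I_n.+1) : (r < n)%N -> S s -> S t ->
  v s 0 r != 0 -> v t 0 r != 0 -> line_graph n s t.
Proof.
move=> ltr [p _ <-] [q _ <-] /(cover_vector_coord ltr)[x [k [px xE]]].
move=> /(cover_vector_coord ltr)[y [m [qy yE]]]; apply/line_graphP.
exists (m - k), x; split=> //; suff <- : y = x + (m - k) * n%:Z by [].
by rewrite yE xE; ring.
Qed.

(** Restrict the dependence [l] to a connected component [Y] of the support.  A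
    residue [r] met by [Y] is met by no other element of the support, so the
    [r]-th coordinate of the restricted sum is either that of the full sum or
    an empty one; both vanish.  The restricted sum is thus a multiple of [b_*],
    killed by [f], hence zero, and [Y] is the whole support by minimality. *)
Lemma circuit_support_connected c f : signed_circuit S v c -> f b_star != 0 ->
  (forall s, signed_support c s -> f (v s) = 0) ->
  induces_connected (line_graph n) (signed_support c).
Proof.
move=> [[l l0 cE] [s0 c_s0] c_min] fb fc.
have finS := finite_cover_classes n_gt0 leP.
have supp (m : set (int * int) -> R) :
    signed_support ([set s | S s /\ 0 < m s], [set s | S s /\ m s < 0]) =
    [set s | S s /\ m s != 0].
  apply/seteqP; split=> s /=.
    by move=> [[Ss ms]|[Ss ms]]; split=> //; [rewrite gt_eqF | rewrite lt_eqF].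
  move=> [Ss]; case: ltgtP => // ms _; [right|left]; by split.
pose X := signed_support c.
have XE s : X s <-> S s /\ l s != 0 by rewrite /X cE supp.
pose Y := [set s | X s /\ reach (line_graph n) X s0 s].
have Ystep s t : Y s -> X t -> line_graph n s t -> Y t.
  by move=> [Xs rs] Xt st; split=> //; apply: reach_trans rs _; exact: reach1.
pose l' s := if `[< Y s >] then l s else 0.
have sumE (V : nmodType) (g : set (int * int) -> V) :
  \sum_(s \in S) g s = \sum_(s <- fset_set S) g s by exact: fsbig_finite.
have inS s : s \in fset_set S -> S s by rewrite in_fset_set // inE.
have l'v_coord (r : 'I_n.+1) : (r < n)%N -> (\sum_(s \in S) l' s *: v s) 0 r = 0.
  move=> ltr; have scE a s : (a *: v s) 0 r = a * v s 0 r by rewrite mxE.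
  have [[t [[Xt rt] vt]]|noY] := pselect (exists t, Y t /\ v t 0 r != 0).
    have <- : (\sum_(s \in S) l s *: v s) 0 r = 0 by rewrite l0 mxE.
    rewrite !sumE !summxE; apply: eq_big_seq => s /inS Ss; rewrite !scE.
    rewrite /l'; case: asboolP => // nYs; rewrite mul0r.
    have [->|vs] := eqVneq (v s 0 r) 0; first by rewrite mulr0.
    have [->|ls] := eqVneq (l s) 0; first by rewrite mul0r.
    case: nYs; apply: (Ystep t) => //; first exact/XE.
    by apply: common_coord_adjacent vt vs => //; case/XE: Xt.
  rewrite sumE summxE big1 // => s _; rewrite scE /l'.
  case: asboolP => [Ys|]; last by rewrite mul0r.
  have [->|vs] := eqVneq (v s 0 r) 0; first by rewrite mulr0.
  by case: noY; exists s.
have l'v : linear_dependence S v l'.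
  rewrite /linear_dependence; set u := \sum_(s \in S) _.
  have uE : u = u 0 ord_max *: b_star.
    apply/rowP => r; rewrite !mxE eqxx /=; have [->|ner] := eqVneq r ord_max.
      by rewrite mulr1.
    rewrite mulr0 l'v_coord //; move: ner; rewrite -val_eqE /= => ner.
    by have := ltn_ord r; rewrite ltnS leq_eqVlt (negPf ner).
  suff u0 : u 0 ord_max = 0 by rewrite uE u0 scale0r.
  have : f u = 0.
    rewrite /u sumE linear_sum big_seq big1 // => s _; rewrite linearZ /= /l'.
    by case: asboolP => [[Xs _]|]; rewrite ?mul0r // fc // mulr0.
  by rewrite {1}uE linearZ /= => /eqP; rewrite mulf_eq0 (negPf fb) orbF => /eqP.
have YE : [set s | S s /\ l' s != 0] = Y.
  apply/seteqP; split=> s /=; rewrite /l'.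
    by case: asboolP => // _ []; rewrite eqxx.
  by move=> Ys; rewrite asboolT //; case: Ys => /XE.
have Ys0 : Y s0 by split=> //; exact: reach_refl.
have := c_min ([set s | S s /\ 0 < l' s], [set s | S s /\ l' s < 0]).
rewrite supp YE => YX.
have {}YX : Y = X.
  by apply: YX; [exists l' | exists s0 | move=> s []].
apply: (connected_from line_graph_sym c_s0) => s Xs.
by have [] : Y s by rewrite YX.
Qed.

(** The second alternative is the trace left by the circuits that go around [n],
    such as the union of two cycles on disjoint element classes, each lifting to
    a path from some [i] to [i + k n] with [k <> 0]. *)
Lemma building_block X : B X -> [/\ X !=set0, X `<=` S
  & induces_connected (line_graph n) X \/
    forall f, f b_star != 0 -> exists2 s, X s & f (v s) != 0].
Proof.
apply: (smallest_sub (X := [set X | [/\ X !=set0, X `<=` S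
  & induces_connected (line_graph n) X \/
    forall f, f b_star != 0 -> exists2 s, X s & f (v s) != 0]])) => [|{}X]; last first.
  move=> [XS [[X0 cX]|[c cc XE]]]; first by split=> //; left.
  split=> //; first by rewrite XE; case: cc.
  have [[f [fb fX]]|nof] :=
      pselect (exists f, f b_star != 0 /\ forall s, X s -> f (v s) = 0).
    left; rewrite XE; apply: circuit_support_connected cc fb _ => s cs.
    by apply: fX; rewrite XE.
  right=> f fb; apply: contrapT => nos; apply: nof; exists f; split=> // s Xs.
  by apply/eqP; apply: contrapT => /negP fs; apply: nos; exists s.
split.
- by move=> Y [].
- move=> s Ss; split; [by exists s | by move=> _ -> |left].
  by move=> x y -> ->; exact: reach_refl.
- move=> Y Z [Y0 YS cY] [Z0 ZS cZ] [y [Yy Zy]]; split.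
  + by exists y; left.
  + by move=> x [/YS|/ZS].
  + case: cY => [cY|cY]; last by right=> f /cY[s Ys fs]; exists s => //; left.
    case: cZ => [cZ|cZ]; last by right=> f /cZ[s Zs fs]; exists s => //; right.
    left; apply: connectedU => //; first exact: line_graph_sym.
    by exists y, y; split=> //; left.
Qed.

Lemma connected_block X : X `<=` S -> X !=set0 ->
  induces_connected (line_graph n) X -> B X.
Proof. by move=> XS X0 cX; apply: sub_gen_smallest; split=> //; left. Qed.

Lemma edges_block Q : pipe n le Q -> B (edges Q).
Proof.
move=> pQ; apply: connected_block; [exact: edges_sub | exact: edges_nonempty |].
exact: edges_connected.
Qed.

Lemma full_block : B S.
Proof. by rewrite -edgesT; apply: edges_block; exact: pipeT. Qed.

Lemma maximal_blocksE : maximal_blocks B = [set S].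
Proof.
apply/seteqP; split=> [X [BX maxX]|X ->].
  by have [_ XS _] := building_block BX; rewrite (maxX S full_block XS).
split=> [|Y BY SY]; first exact: full_block.
by have [_ YS _] := building_block BY; apply/seteqP.
Qed.

(** A form that exhibits a face [X <> S] is nonzero at [b_*], which excludes the
    second alternative of [building_block]. *)
Lemma block_face_connected X : B X -> face S v X -> induces_connected (line_graph n) X.
Proof.
move=> BX [XS [f [f0 fpos]]].
have [->|/eqP neXS] := eqVneq X S.
  by rewrite -edgesT; apply: edges_connected; exact: pipeT.
have := height_step_gt0 XS neXS (form_height f0 fpos).
rewrite oppr_gt0 => fb; have [_ _ [//|/(_ f)[|s Xs]]] := building_block BX.
  by rewrite lt_eqF.
by rewrite f0 // eqxx.
Qed.

Lemma block_face_pipe X : B X -> face S v X -> exists2 Q, pipe n le Q & X = edges Q.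
Proof.
move=> BX fX; have [X0 XS _] := building_block BX.
have [->|/eqP neXS] := eqVneq X S.
  by exists setT; [exact: pipeT | rewrite edgesT].
exact: connected_face_pipe XS X0 neXS fX (block_face_connected BX fX).
Qed.

End BuildingSet.

(** * Pipes are determined by their edges *)
Lemma pipe_translate k Q : pipe n le Q -> pipe n le (translate n k Q).
Proof.
move=> [thQ cvQ cQ [a [b [Qa Qb neab]]]]; split.
- case: thQ => [->|thQ]; first by left; rewrite translateT.
  right=> x y z [/mem_translate Qy [i _ yE]] [/mem_translate Qz [j _ zE]].
  have := thQ x _ _ (conj Qy _) (conj Qz _) => /(_ _ _)/addIr; apply.
    by exists (i - k) => //; rewrite -yE; ring.
  by exists (j - k) => //; rewrite -zE; ring.
- move=> x y z xy yz /mem_translate Qx /mem_translate Qz; apply/mem_translate.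
  by apply: cvQ Qx Qz; rewrite -mulNr affine_shiftz.
- have Qka := translate_shift k Qa.
  apply: (connected_from hasse_sym Qka) => y /mem_translate Qy.
  have Q1 : Q `<=` [set x | reach (hasse le) (translate n k Q)
      (a + k * n%:Z) (x + k * n%:Z)].
    apply: (connected_ind cQ Qa) => [|u w ru Qw uw]; first exact: reach_refl.
    apply: reach_trans ru _; apply: reach1; last exact: translate_shift.
    move: uw => /asboolP uw; apply/asboolP.
    by case: uw => uw; [left|right]; apply/covers_shift.
  by have := Q1 _ Qy; rewrite /= subrK.
- exists (a + k * n%:Z), (b + k * n%:Z).
  by split; [exact: translate_shift|exact: translate_shift|move/addIr].
Qed.

Lemma pipe_class_pipe Q : pipe_class n le (subset_class n Q) -> pipe n le Q.
Proof.
move=> [Q0 pQ0 QE]; have := subset_class_id Q; rewrite QE => /mem_subset_class[k ->].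
exact: pipe_translate.
Qed.

Lemma edges_inj Q Q' : pipe n le Q -> pipe n le Q' -> edges Q = edges Q' ->
  exists k, Q' = translate n k Q.
Proof.
move=> pQ pQ' EQ; have [k QQ'] : exists k, translate n k Q `<=` Q'.
  by apply: edges_subset; rewrite // EQ.
have [m Q'Q] : exists m, translate n m Q' `<=` Q by apply: edges_subset; rewrite // EQ.
have [Q'T|/eqP Q'T] := eqVneq Q' setT.
  exists 0; rewrite translate0 Q'T; apply/esym/seteqP; split=> // x _.
  by apply: Q'Q; rewrite Q'T translateT.
exists k; apply/seteqP; split=> //.
have Q'sub := translate_subset Q'Q; suff mk : - m = k by rewrite -mk.
have Q'2 : Q' `<=` translate n (- m - k) Q'.
  apply: (subset_trans Q'sub); have := translateS (k := - m - k) QQ'.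
  by rewrite translateD subrK.
have [thQ' _ _ _] := pQ'; have := proper_thin_subset thQ' Q'T (pipe_nonempty pQ') Q'2.
by lia.
Qed.

Lemma translate_meet Q k x : pipe n le Q -> Q <> setT -> Q x -> translate n k Q x ->
  translate n k Q = Q.
Proof.
move=> [thQ _ _ _] QT Qx /mem_translate Qxk.
suff /eqP : - k = 0 by rewrite oppr_eq0 => /eqP ->; rewrite translate0.
by apply: (proper_thin thQ QT Qx); rewrite mulNr.
Qed.

Lemma nested_edges Q Q' : nested_classes n Q Q' -> nested (edges Q) (edges Q').
Proof. by case=> k [/edgesS|/edgesS]; rewrite edges_translate; [left|right]. Qed.

Lemma edges_full Q : pipe n le Q -> edges Q = S -> Q = setT.
Proof.
rewrite -edgesT => pQ EQ; have [k Qk] := edges_inj pipeT pQ (esym EQ).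
by rewrite Qk translateT.
Qed.

(** * Contracting disjoint pipes *)
Section Contraction.
Variable V : set (set int).
Hypothesis V_pipe : forall Q, V Q -> pipe n le Q.
Hypothesis V_proper : forall Q, V Q -> Q <> setT.
Hypothesis V_translate : forall k Q, V Q -> V (translate n k Q).
Hypothesis V_disjoint : forall Q Q', V Q -> V Q' -> Q = Q' \/ Q `&` Q' = set0.
Hypothesis V_acyclic : ~ has_directed_cycle (precedes le) V.

Lemma acyclic_reach Q Q' : V Q -> reach (precedes le) V Q Q' -> ~ precedes le Q' Q.
Proof.
move=> VQ [s [+ <-]] Vs; case/shortenP => s' es' us' ss' lastQ.
apply: V_acyclic; exists (Q :: s'); split=> //.
  by rewrite /ucycle us' /= rcons_path es' lastQ.
by move=> A; rewrite inE => /orP[/eqP->//|/ss'/Vs].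
Qed.

(** The order generated by [le] once each member of [V] is shrunk to a point.  As
    [le] is transitive and the members of [V] are pairwise equal or disjoint,
    one run through members of [V] along arcs is enough. *)
Definition contracted_le x y := le x y \/ exists Q Q' q q',
  [/\ V Q, V Q', reach (precedes le) V Q Q' & [/\ Q q, Q' q', le x q & le q' y]].

Lemma reach_le Q Q' q q' : V Q -> V Q' -> Q q -> Q' q' -> le q q' ->
  reach (precedes le) V Q Q'.
Proof.
move=> VQ VQ' Qq Qq' qq'; have [->|dQ] := V_disjoint VQ VQ'; first exact: reach_refl.
apply: reach1 => //; apply/asboolP; split=> //; exists q, q'; split=> //.
rewrite /aff_lt qq'; apply/eqP => eqq.
suff : (Q `&` Q') q by rewrite dQ.
by split; rewrite // eqq.
Qed.

(** A return from [j] to [i] through distinct pipes would close a directed cycle;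
    if it uses a single pipe, convexity puts [i] and [j] in that pipe. *)
Lemma contracted_back i j : aff_lt le i j -> contracted_le j i ->
  exists2 Q, V Q & Q i /\ Q j.
Proof.
move=> /andP[ij /eqP neij] [ji|[Q [Q' [q [q' [VQ VQ' rQ [Qq Qq' jq qi]]]]]]].
  by case: neij; apply: (affine_anti leP); rewrite ij ji.
have iq := affine_trans leP ij jq; have qj := affine_trans leP qi ij.
have qq := affine_trans leP qi iq.
have [QQ|dQ] := V_disjoint VQ VQ'.
  exists Q => //; case: (V_pipe VQ) => _ cvQ _ _; rewrite -QQ in Qq'.
  by split; apply: (cvQ q' _ q).
case: (acyclic_reach VQ rQ); apply/asboolP; split; first by rewrite setIC.
exists q', q; split=> //; rewrite /aff_lt qq; apply/eqP => eqq.
suff : (Q `&` Q') q by rewrite dQ.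
by split; rewrite // -eqq.
Qed.

Lemma contraction_height (R : realType) : exists (h : int -> R) (c : R),
  height (\bigcup_(Q in V) edges Q) h c.
Proof.
have sq_shift k x y : contracted_le x y ->
    contracted_le (x + k * n%:Z) (y + k * n%:Z).
  case=> [xy|[Q [Q' [q [q' [VQ VQ' rQ [Qq Qq' xq qy]]]]]]]; [left|right].
    by rewrite affine_shiftz.
  exists (translate n k Q), (translate n k Q'), (q + k * n%:Z), (q' + k * n%:Z).
  split; [exact: V_translate | exact: V_translate | |].
    apply: (reach_ind (U := fun A => reach (precedes le) V (translate n k Q)
        (translate n k A)) _ _ rQ) => [|A A' rA AA' VA']; first exact: reach_refl.
    apply: reach_trans rA _; apply: reach1; last exact: V_translate.
    move: AA' => /asboolP[dA [a [a' [Aa Aa' aa']]]]; apply/asboolP; split.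
      rewrite -subset0 => z [/mem_translate Az /mem_translate Az'].
      by suff : (A `&` A') (z - k * n%:Z) by rewrite dA.
    exists (a + k * n%:Z), (a' + k * n%:Z).
    by split; [exact: translate_shift|exact: translate_shift|rewrite aff_lt_shift].
  by split; [exact: translate_shift|exact: translate_shift|rewrite affine_shiftz..].
have [||||||h [hD h_mono h_lt]] := @affine_height n contracted_le n_gt0.
- by move=> i; left; exact: affine_refl leP i.
- move=> x y z [xy|[Q [Q' [q [q' [VQ VQ' rQ [Qq Qq' xq qy]]]]]]].
    move=> [yz|[Q [Q' [q [q' [VQ VQ' rQ [Qq Qq' yq qz]]]]]]].
      by left; exact: (affine_trans leP xy yz).
    right; exists Q, Q', q, q'; split=> //; split=> //; exact: (affine_trans leP xy yq).
  move=> [yz|[A [A' [a [a' [VA VA' rA [Aa Aa' ya az]]]]]]]; right.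
    exists Q, Q', q, q'; split=> //; split=> //; exact: (affine_trans leP qy yz).
  exists Q, A', q, a'; split=> //; apply: (reach_trans rQ); apply: reach_trans rA.
  apply: (reach_le VQ' VA Qq' Aa); exact: (affine_trans leP qy ya).
- exact: sq_shift.
- by move=> i; left; case/andP: (affine_shift_lt leP i).
- by move=> i j; have [k ?] := affine_cofinal leP i j; exists k%:Z; left.
- move=> i /contracted_back[|Q VQ [Qi Qin]]; first exact: affine_shift_lt.
  have [thQ _ _ _] := V_pipe VQ.
  by have := proper_thin (k := 1) thQ (V_proper VQ) Qi; rewrite mul1r => /(_ Qin).
exists (fun i => (h i)%:~R), n%:R.
split=> [i k|i j cij]; first by rewrite hD intrD intrM.
split=> [[Q VQ /mem_edges[_ [k [Qi Qj]]]]|nF].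
  congr (_ %:~R); apply: (addIr (k * n%:Z)); rewrite -!hD; apply/eqP; rewrite eq_le.
  apply/andP; split; apply: h_mono; right; exists Q, Q.
    exists (i + k * n%:Z), (j + k * n%:Z).
    by split=> //; [exact: reach_refl | split=> //; exact: affine_refl leP _].
  exists (j + k * n%:Z), (i + k * n%:Z).
  by split=> //; [exact: reach_refl | split=> //; exact: affine_refl leP _].
rewrite ltr_int; apply: h_lt; first by left; exact: coversW.
move=> /contracted_back[|Q VQ [Qi Qj]]; first by case: cij.
by apply: nF; exists Q => //; exists (i, j).
Qed.

End Contraction.

(** * The correspondence between pipings and acyclic nested sets *)
Definition class_edges (C : set (set int)) : set (set (int * int)) :=
  \bigcup_(Q in C) edges Q.

Lemma class_edgesE Q : class_edges (subset_class n Q) = edges Q.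
Proof.
apply/seteqP; split=> [s [_ /mem_subset_class[k ->]]|s Es].
  by rewrite edges_translate.
by exists Q => //; exact: subset_class_id.
Qed.

Lemma class_edges_inj C C' : pipe_class n le C -> pipe_class n le C' ->
  class_edges C = class_edges C' -> C = C'.
Proof.
move=> [Q pQ ->] [Q' pQ' ->]; rewrite !class_edgesE => /(edges_inj pQ pQ')[k ->].
by rewrite subset_class_translate.
Qed.

Definition laminar (X : set (set (set int))) := forall Q Q',
  X (subset_class n Q) -> X (subset_class n Q') ->
  nested_classes n Q Q' \/ disjoint_classes n Q Q'.

(** An edge of the union that meets [Q] comes from a pipe that is not disjoint
    from [Q] up to translation, hence is nested with it, and maximality puts the
    edge in [edges Q]; by thinness it is the translate lying in [Q] itself that
    was met. *)
Lemma maximal_pipe_closed (X : set (set (set int))) (N : set (set (set (int * int)))) Q :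
  laminar X ->
  (forall W, N W -> exists Q', [/\ pipe n le Q', X (subset_class n Q') & W = edges Q']) ->
  pipe n le Q -> Q <> setT -> X (subset_class n Q) ->
  (forall W, N W -> edges Q `<=` W -> W `<=` edges Q) ->
  forall x y, Q x -> lift (\bigcup_(W in N) W) x y -> Q y.
Proof.
move=> lamX NX pQ QT XQ maxQ x y Qx.
have [thQ _ _ _] := pQ.
have main i j (W : set (set (int * int))) : N W -> W (pair_class n (i, j)) ->
    Q i \/ Q j -> Q i /\ Q j.
  move=> NW Wij Qij; have [Q' [pQ' XQ' WE]] := NX _ NW.
  move: (Wij); rewrite WE => /mem_edges[cij [k [Q'i Q'j]]].
  have nQ : edges Q `<=` W \/ W `<=` edges Q.
    rewrite WE; have [/nested_edges //|dQ] := lamX _ _ XQ XQ'.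
    have dk := dQ k; case: Qij => /(translate_shift k) Qk.
      by suff : (translate n k Q `&` Q') (i + k * n%:Z) by rewrite dk.
    by suff : (translate n k Q `&` Q') (j + k * n%:Z) by rewrite dk.
  have /(_ _ Wij)/mem_edges[_ [m [Qi Qj]]] : W `<=` edges Q.
    by case: nQ => // /(maxQ _ NW).
  have m0 : m = 0 by case: Qij => /(proper_thin thQ QT) /(_ _); apply.
  by move: Qi Qj; rewrite m0 !mul0r !addr0.
move=> /asboolP[[_ [W NW Wxy]]|[_ [W NW Wyx]]].
  by case: (main _ _ _ NW Wxy); auto.
by case: (main _ _ _ NW Wyx); auto.
Qed.

Section Correspondence.
Context {R : realType}.
Local Notation v := (@cover_vector n R).
Local Notation B := (affine_building_set n le R).

(** Contract the inclusion-maximal pipes among those with edge set in [N]. *)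
Lemma piping_face (X : set (set (set int))) (N : set (set (set (int * int)))) :
  piping n le X -> N `<=` class_edges @` X -> face S v (\bigcup_(W in N) W).
Proof.
move=> [Xpipe XT lamX acX] NX.
have NX' W : N W -> exists Q, [/\ pipe n le Q, X (subset_class n Q) & W = edges Q].
  move=> /NX[C XC <-]; have [Q pQ CE] := Xpipe _ XC; exists Q.
  by rewrite -CE CE class_edgesE -CE.
have NS W : N W -> W `<=` S by move=> /NX'[Q [_ _ ->]]; exact: edges_sub.
have [N_S|N_S] := pselect (N S).
  suff -> : \bigcup_(W in N) W = S by exact: face_full.
  apply/seteqP; split=> [s [W /NS WS /WS //]|s Ss]; by exists S.
have finS := finite_cover_classes n_gt0 leP.
(* all translates are kept, as the contraction must commute with translations *)
pose V := [set Q | [/\ pipe n le Q, X (subset_class n Q), N (edges Q)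
  & forall W, N W -> edges Q `<=` W -> W `<=` edges Q]].
have VE : \bigcup_(W in N) W = \bigcup_(Q in V) edges Q.
  apply/seteqP; split=> [s [W NW Ws]|s [Q [_ _ NQ _] Qs]]; last by exists (edges Q).
  have [M [NM WM maxM]] := maximal_above finS NS NW.
  have [Q [pQ XQ ME]] := NX' _ NM; rewrite ME in NM WM maxM.
  by exists Q; [split | exact: WM].
have V_proper Q : V Q -> Q <> setT.
  by move=> [_ _ NQ _] QT; move: NQ; rewrite QT edgesT.
apply/face_heightP; split; first by move=> s [W /NS WS /WS].
rewrite VE; have [|||||h [c hV]] := @contraction_height V _ _ _ _ _ R.
- by move=> Q [].
- exact: V_proper.
- move=> k Q [pQ XQ NQ maxQ]; split.
  + exact: pipe_translate.
  + by rewrite subset_class_translate.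
  + by rewrite edges_translate.
  + by rewrite edges_translate.
- move=> Q Q' VQ VQ'; have [pQ XQ NQ maxQ] := VQ; have [pQ' XQ' NQ' maxQ'] := VQ'.
  have [/nested_edges QQ'|/(_ 0)] := lamX _ _ XQ XQ'; last by rewrite translate0; right.
  have EQ : edges Q = edges Q'.
    apply/seteqP; case: QQ' => QQ'; split=> //; first exact: maxQ.
    exact: maxQ'.
  have [k Q'E] := edges_inj pQ pQ' EQ.
  have [[x [Qx Q'x]]|noI] := pselect (Q `&` Q' !=set0).
    by left; rewrite Q'E (translate_meet pQ (V_proper _ VQ) Qx) // -Q'E.
  by right; apply: contrapT => /eqP/set0P.
- move=> [c [c0 cyc cV]]; apply: acX; exists c; split=> // Q /cV[_ XQ _ _].
  by exists (subset_class n Q) => //; exact: subset_class_id.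
by exists h, c.
Qed.

(** For the last condition of nested sets: a union of disjoint edge sets that is a
    block is also a face, hence connected in the line graph; but two adjacent
    edges cannot come from pipes that are disjoint up to translation. *)
Lemma piping_acyclic_nested (X : set (set (set int))) :
  piping n le X -> acyclic_nested_set S v B (class_edges @` X).
Proof.
move=> pX; have [Xpipe XT lamX acX] := pX; split; last by move=> N; exact: piping_face.
have N_edges W : (class_edges @` X) W ->
    exists Q, [/\ pipe n le Q, X (subset_class n Q) & W = edges Q].
  move=> [C XC <-]; have [Q pQ CE] := Xpipe _ XC; exists Q.
  by rewrite -CE CE class_edgesE -CE.
have meet_nested Q Q' C C' : pipe n le Q -> pipe n le Q' ->
    X (subset_class n Q) -> X (subset_class n Q') ->
    edges Q C -> edges Q' C' -> C = C' \/ line_graph n C C' -> nested (edges Q) (edges Q').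
  move=> pQ pQ' XQ XQ' EC EC' CC'.
  have [/nested_edges //|dQ] := lamX _ _ XQ XQ'; exfalso.
  case: EC EC' CC' => p [cp Q1 Q2 <-] [q [cq Q'1 Q'2 <-]] pq.
  have [k [x [px qx]]] : exists k x, end_of p x /\ end_of q (x + k * n%:Z).
    case: pq => [/esym/pair_class_eq[k qE]|/line_graphP //].
    by exists k, p.1; split; [left | left; rewrite qE].
  have : (translate n k Q `&` Q') (x + k * n%:Z).
    by split; [apply: translate_shift; case: px => -> | case: qx => ->].
  by rewrite (dQ k).
split.
- by move=> W /N_edges[Q [pQ _ ->]]; exact: edges_block.
- rewrite maximal_blocksE => _ ->; exists (subset_class n setT) => //.
  by rewrite class_edgesE edgesT.
- move=> W W' /N_edges[Q [pQ XQ ->]] /N_edges[Q' [pQ' XQ' ->]].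
  have [[C [QC Q'C]]|noI] := pselect (edges Q `&` edges Q' !=set0).
    by left; apply: meet_nested QC Q'C _ => //; left.
  by right; apply: contrapT => /eqP/set0P.
- move=> k F k2 NF trivF BU.
  have FU : [set F i | i in `I_k] `<=` class_edges @` X by move=> _ [i /NF ? <-].
  have fU : face S v (\bigcup_(i < k) F i).
    have := piping_face pX FU; congr face.
    by apply/seteqP; split=> [s [_ [i ik <-] Fs]|s [i ik Fs]];
      [exists i | exists (F i) => //; exists i].
  have cU := block_face_connected BU fU.
  have k0 : (0 < k)%N by exact: ltnW.
  have F_ne (i : nat) : (i < k)%N -> F i !=set0.
    by move=> /NF/N_edges[Q [pQ _ ->]]; exact: edges_nonempty.
  have [s Fs] := F_ne _ k0; have [t Ft] := F_ne _ k2.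
  have U0 : (\bigcup_(i < k) F i) s by exists 0%N.
  (* F 0 is closed under adjacency in the connected union *)
    have UF : \bigcup_(i < k) F i `<=` F 0%N.
    apply: (connected_ind cU U0 Fs) => C C' FC [i ik FC'] CC'.
    have [Q [pQ XQ QE]] := N_edges _ (NF _ k0).
    have [Q' [pQ' XQ' QE']] := N_edges _ (NF _ ik).
    have nst : nested (F 0%N) (F i).
      by rewrite QE QE'; apply: meet_nested; rewrite -?QE -?QE'; eauto.
    have [z [Fz0 Fzi]] : F 0%N `&` F i !=set0.
      by case: nst => sub; [exists C | exists C'] ; split=> //; apply: sub.
    have -> // : 0%N = i; apply: (trivF 0%N i) => //; by exists z.
  have : 0%N = 1%N; last by [].
  apply: (trivF 0%N 1%N) => //; exists t; split=> //; apply: UF; by exists 1%N.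
Qed.

Section FromNested.
Variable N : set (set (set (int * int))).
Hypothesis nestedN : acyclic_nested_set S v B N.

Definition pipe_classes_of := [set C | pipe_class n le C /\ N (class_edges C)].
Local Notation X := pipe_classes_of.

Lemma nested_pipe W : N W -> exists2 Q, pipe n le Q & W = edges Q.
Proof.
move=> NW; have [[NB _ _ _] faceN] := nestedN; apply: block_face_pipe (NB _ NW) _.
have := faceN [set W] _; rewrite bigcup_set1; apply; by move=> _ ->.
Qed.

Lemma mem_pipe_classes_of Q : X (subset_class n Q) <-> pipe n le Q /\ N (edges Q).
Proof.
split=> [[/pipe_class_pipe pQ]|[pQ NQ]]; first by rewrite class_edgesE.
by split; [exists Q | rewrite class_edgesE].
Qed.

Lemma class_edges_pipe_classes_of : class_edges @` X = N.
Proof.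
apply/seteqP; split=> [_ [C [_ NC] <-] //|W NW].
have [Q pQ WE] := nested_pipe NW; exists (subset_class n Q).
  by apply/mem_pipe_classes_of; rewrite -WE.
by rewrite class_edgesE.
Qed.

(** Disjoint edge sets may come from pipes with a common element, but then their
    union is connected, hence a block, against the definition of nested sets. *)
Lemma pipe_classes_of_laminar : laminar X.
Proof.
move=> Q Q' /mem_pipe_classes_of[pQ NQ] /mem_pipe_classes_of[pQ' NQ'].
have [[NB _ nstN disjN] _] := nestedN.
have [[QQ'|Q'Q]|dE] := nstN _ _ NQ NQ'.
- by have [k ?] := edges_subset pQ pQ' QQ'; left; exists k; left.
- have [k ?] := edges_subset pQ' pQ Q'Q; left; exists (- k); right.
  exact: translate_subset.
right=> k; rewrite /disjoint_sets -subset0 => x [/mem_translate Qx Q'x].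
have [p [Ep _ _ px]] := edges_at pQ Qx; have [q [Eq _ _ qx]] := edges_at pQ' Q'x.
pose F (i : nat) := if i == 0%N then edges Q else edges Q'.
have FE : \bigcup_(i < 2) F i = edges Q `|` edges Q'.
  apply/seteqP; split=> [s [[|i] _ Fs]|s [Fs|Fs]]; [by left | by right | |].
    by exists 0%N.
  by exists 1%N.
apply: (disjN 2%N F) => //.
- by move=> i _; rewrite /F; case: eqP.
- by move=> [|[|i]] [|[|j]] //= _ _ [s []]; rewrite /F /= => E1 E2;
    have : (edges Q `&` edges Q') s by [|split]; rewrite dE.
rewrite FE; apply: connected_block.
- by move=> s [/edges_sub|/edges_sub].
- by have [s Es] := edges_nonempty pQ; exists s; left.
apply: connectedU; [exact: line_graph_sym | exact: edges_connected | exact: edges_connected |].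
exists (pair_class n p), (pair_class n q); split=> //; right; apply/line_graphP.
by exists k, (x - k * n%:Z); split=> //; rewrite subrK.
Qed.

(** The height of the union of the edge sets is constant on each pipe of the cycle
    and weakly increases along it, hence is constant on the cycle; the maximal
    pipe [Q] and its successor [Q'] would then lie in the same component. *)
Lemma pipe_classes_of_acyclic :
  ~ has_directed_cycle (precedes le) (\bigcup_(C in X) C).
Proof.
move=> [c [c_ne /andP[cyc _] cX]]; have finS := finite_cover_classes n_gt0 leP.
have cP Q : Q \in c -> pipe n le Q /\ N (edges Q).
  move=> /cX[C [pC NC] CQ]; apply/mem_pipe_classes_of; split; last first.
    by case: pC NC CQ => Q0 _ -> NC /mem_subset_class[k ->]; rewrite subset_class_translate.
  case: pC NC CQ => Q0 pQ0 -> NC /mem_subset_class[k ->].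
  by rewrite subset_class_translate; exists Q0.
have c_next Q : Q \in c -> precedes le Q (next c Q) /\ next c Q \in c.
  by move=> Qc; rewrite mem_next Qc; split=> //; exact: next_cycle.
have c_proper Q : Q \in c -> Q <> setT.
  move=> Qc QT; have [/asboolP[+ _] Q'c] := c_next _ Qc.
  have [x Q'x] := pipe_nonempty (cP _ Q'c).1.
  by rewrite {1}QT setTI => Q'0; rewrite Q'0 in Q'x.
pose N' := [set edges Q | Q in [set Q | Q \in c]].
have N'N : N' `<=` N by move=> _ [Q /cP[_ NQ] <-].
have N'S : ~ N' S.
  by move=> [Q Qc QS]; apply: (c_proper Q Qc); apply: edges_full QS; case: (cP _ Qc).
have N'edges W : N' W -> exists Q, [/\ pipe n le Q, X (subset_class n Q) & W = edges Q].
  by move=> [Q /cP[pQ NQ] <-]; exists Q; split=> //; apply/mem_pipe_classes_of.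
have [_ /(_ N' N'N)/face_heightP[FS [h [d hF]]]] := nestedN.
have h_const Q x y : Q \in c -> Q x -> Q y -> h x = h y.
  move=> Qc Qx Qy; have [_ _ cQ _] := (cP _ Qc).1.
  suff : Q `<=` [set z | Q z /\ h x = h z] by move=> /(_ y Qy)[].
  apply: (connected_ind cQ Qx) => // u w [Qu xu] Qw uw; split=> //; rewrite xu.
  apply: (height_lift hF); move: uw => /asboolP[uw|wu]; apply/asboolP; [left|right];
    split=> //; exists (edges Q); do ?by exists Q.
    by exists (u, w).
  by exists (w, u).
have [Q0 Q0c] : exists Q, Q \in c.
  by case: (c) c_ne => // Q c' _; exists Q; rewrite inE eqxx.
have [||M [[Q Qc <-] _ maxQ]] := @maximal_above _ _ N' (edges Q0) finS.
- by move=> Y /N'edges[Q [_ _ ->]]; exact: edges_sub.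
- by exists Q0.
have [pQ NQ] := cP _ Qc; have QT := c_proper _ Qc.
have XQ : X (subset_class n Q) by apply/mem_pipe_classes_of.
have closed := maximal_pipe_closed pipe_classes_of_laminar N'edges pQ QT XQ maxQ.
have [Q' [Q'c Q'Q QQ']] : exists Q', [/\ Q' \in c,
    reach (precedes le) [set A | A \in c] Q' Q & precedes le Q Q'].
  have [i s cE] := rot_to Qc; have mem_s A : A \in Q :: s -> A \in c.
    by rewrite -cE mem_rot.
  have : cycle (precedes le) (Q :: s) by rewrite -cE rot_cycle.
  case: s {cE} mem_s => [|Q' s] mem_s /= /andP[QQ' path_s].
    by exists Q; split=> //; exact: reach_refl.
  exists Q'; split=> //; first by apply: mem_s; rewrite !inE eqxx orbT.
  exists (rcons s Q); split; rewrite ?last_rcons // => A.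
  rewrite mem_rcons => As; apply: mem_s; move: As.
  by rewrite !inE => /orP[->//|->]; rewrite !orbT.
have back : forall x y, Q' x -> Q y -> h x <= h y.
  suff [] : Q \in c /\ forall x y, Q' x -> Q y -> h x <= h y by [].
  apply: (reach_ind (U := fun A => A \in c /\ forall x y, Q' x -> A y -> h x <= h y) _ _ Q'Q).
    by split=> // x y Q'x Q'y; rewrite (h_const Q' x y).
  move=> A A' [Ac leA] /asboolP[_ [a [a' [Aa A'a' /andP[aa' _]]]]] A'c; split=> // x y Q'x A'y.
  apply: (le_trans (leA _ _ Q'x Aa)); rewrite (h_const A' y a') //.
  by case: (height_le hF aa').
move: QQ' => /asboolP[dQ [q [q' [Qq Qq' /andP[qq' _]]]]].
have [leqq rqq] := height_le hF qq'.
have {}rqq : reach (lift (\bigcup_(W in N') W)) setT q q'.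
  by apply: rqq; apply/eqP; rewrite eq_le leqq back.
have Qq'1 : Q q' by apply: (reach_ind Qq _ rqq) => u w Qu uw _; exact: closed uw.
by have : (Q `&` Q') q' by []; rewrite dQ.
Qed.

End FromNested.

Lemma acyclic_nested_piping (N : set (set (set (int * int)))) :
  acyclic_nested_set S v B N ->
  exists2 X, piping n le X & class_edges @` X = N.
Proof.
move=> nestedN; exists (pipe_classes_of N); last exact: class_edges_pipe_classes_of.
split; first by move=> C [].
- apply/mem_pipe_classes_of; split; first exact: pipeT.
  by rewrite edgesT; case: nestedN => -[_ + _ _] _; rewrite maximal_blocksE; apply.
- exact: pipe_classes_of_laminar.
- exact: pipe_classes_of_acyclic.
Qed.

End Correspondence.

End PosetGeometry.

Theorem proposition11p7 (R : realType) (n : nat) (le : rel int)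
    (n_gt0 : (0 < n)%N) (leP : affine_poset n le) :
  complex_isomorphic
    (affine_piping_complex n le)
    (acyclic_nested_complex (cover_classes n le) (@cover_vector n R)
       (affine_building_set n le R)).
Proof.
set S := cover_classes n le; set v := @cover_vector n R.
set B := affine_building_set n le R; set phi := class_edges n le.
have phi_inj C C' : pipe_class n le C -> pipe_class n le C' -> phi C = phi C' -> C = C'.
  exact: class_edges_inj.
have classT : pipe_class n le (subset_class n setT) by exists setT => //; exact: pipeT.
have phiT : phi (subset_class n setT) = S by rewrite /phi class_edgesE // edgesT.
have maxB : maximal_blocks B = [set S] by exact: maximal_blocksE.
have phiD X : piping n le X ->
    phi @` (X `\` [set subset_class n setT]) = (phi @` X) `\` [set S].
  move=> [Xpipe _ _ _]; apply/seteqP; split=> [_ [C [XC CT] <-]|_ [[C XC <-] CS]].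
    split; first by exists C.
    by rewrite -phiT => /(phi_inj _ _ (Xpipe _ XC) classT).
  by exists C => //; split=> // CT; apply: CS; rewrite CT.
have vertexP C : vertices (affine_piping_complex n le) C <->
    C <> subset_class n setT /\ exists2 X, piping n le X & X C.
  split=> [[_ [X pX <-] [XC CT]]|[CT [X pX XC]]]; first by split=> //; exists X.
  by exists (X `\` [set subset_class n setT]) => //; exists X.
have vertex_pipe C : vertices (affine_piping_complex n le) C -> pipe_class n le C.
  by move=> /vertexP[_ [X [Xpipe _ _ _] /Xpipe]].
have faceD X : piping n le X ->
    acyclic_nested_complex S v B (phi @` (X `\` [set subset_class n setT])).
  move=> pX; exists (phi @` X); first exact: piping_acyclic_nested.
  by rewrite maxB phiD.
have face_piping F : acyclic_nested_complex S v B F ->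
    exists2 X, piping n le X & F = phi @` (X `\` [set subset_class n setT]).
  move=> [N nN <-]; have [X pX XN] := acyclic_nested_piping n_gt0 leP nN.
  by exists X; rewrite // phiD // maxB XN.
exists phi; split.
  split.
  - move=> C CV; have /vertexP[CT [X pX XC]] := CV.
    exists (phi @` (X `\` [set subset_class n setT])); first exact: faceD.
    by exists C.
  - move=> C C' /set_mem/vertex_pipe pC /set_mem/vertex_pipe; exact: phi_inj.
  - move=> W [F /face_piping[X pX ->] [C [XC CT] <-]]; exists C => //.
    by apply/vertexP; split=> //; exists X.
move=> F FV; split=> [[X pX <-]|/face_piping[X pX FE]]; first exact: faceD.
exists X => //; have [Xpipe _ _ _] := pX.
apply/seteqP; split=> [C [XC CT]|C FC].
  have : (phi @` F) (phi C) by rewrite FE; exists C.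
  move=> [C' FC' /phi_inj <-//]; [exact/vertex_pipe/FV | exact: Xpipe].
have : (phi @` (X `\` [set subset_class n setT])) (phi C) by rewrite -FE; exists C.
move=> [C' [XC' CT'] /phi_inj <-//]; [exact: Xpipe | exact/vertex_pipe/FV].
Qed.
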